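(* Let $I=[\alpha_0,\alpha_1]\subset(0,1)$ be a compact interval, $\lambda_0>0$, and $N\in\mathbb{N}$, $N\ge 1$. There exist constants $C=C(I,\lambda_0,N)>0$ and $T=T(I,\lambda_0,N)>1$ such that, for all $\alpha\in I$, $\lambda\ge\lambda_0$, and $t\ge T$, $$E_{\alpha,1}(-\lambda t^\alpha)=\sum_{k=1}^{N}c_k(\alpha)\lambda^{-k}t^{-k\alpha}+R_N(\alpha,\lambda,t),$$ where $$|R_N(\alpha,\lambda,t)|\le C\lambda^{-(N+1)}t^{-(N+1)\alpha}.$$ Furthermore, $$\partial_\alpha E_{\alpha,1}(-\lambda t^\alpha)=\sum_{k=1}^{N}\lambda^{-k}t^{-k\alpha}\bigl(c_k'(\alpha)-k\,c_k(\alpha)\log t\bigr)+\partial_\alpha R_N(\alpha,\lambda,t),$$ with $$|\partial_\alpha R_N(\alpha,\lambda,t)|\le C(1+\log t)\lambda^{-(N+1)}t^{-(N+1)\alpha}.$$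
   Context: $E_{\alpha,1}(z)=\sum_{j=0}^\infty \frac{z^j}{\Gamma(\alpha j+1)}$ is the Mittag-Leffler function. For $k\in\mathbb{N}$, $k\ge1$, $c_k(\alpha)=\frac{(-1)^{k+1}}{\Gamma(1-k\alpha)}$, where $1/\Gamma$ is the entire reciprocal gamma function (so $c_k$ is smooth on $(0,1)$ and $c_k(\alpha)=0$ when $1-k\alpha$ is a non-positive integer). The derivative $\partial_\alpha E_{\alpha,1}(-\lambda t^\alpha)$ is the derivative of the composite map $\alpha\mapsto E_{\alpha,1}(-\lambda t^\alpha)$ at fixed $\lambda,t$. *)

(* Defs.v *)
From HB Require Import structures.
From mathcomp Require Import all_boot all_order all_algebra.
From mathcomp Require Import all_classical all_reals all_analysis.

Set Implicit Arguments.
Unset Strict Implicit.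
Unset Printing Implicit Defensive.

Import Order.TTheory GRing.Theory Num.Theory.
Import numFieldNormedType.Exports.

Local Open Scope classical_set_scope.
Local Open Scope ring_scope.

(* Euler's integral; meaningful only for 0 < x. *)
Definition Gamma (R : realType) (x : R) : R :=
  \int[lebesgue_measure]_(u in `]0, +oo[) (u `^ (x - 1) * expR (- u)).

(* The restriction to the real line of the entire function 1 / Gamma. For
   x <= 0 it is obtained from the functional equation of Gamma, which gives
   1 / Gamma(x) = x (x + 1) ... (x + m - 1) / Gamma(x + m); the integer m chosen
   here satisfies 0 < x + m <= 1. The product vanishes exactly when x is a
   non-positive integer. *)
Definition recip_Gamma (R : realType) (x : R) : R :=
  if 0 < x then (Gamma x)^-1
  else let m := (Num.truncn (- x)).+1 in
       (\prod_(i < m) (x + i%:R)) / Gamma (x + m%:R).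

(* E_{a,1}(z), for real a > 0 and real z. *)
Definition mittag_leffler (R : realType) (a z : R) : R :=
  limn (series [sequence z ^+ j / Gamma (a * j%:R + 1)]_j).

Definition ml_coef (R : realType) (k : nat) (a : R) : R :=
  (-1) ^+ k.+1 * recip_Gamma (1 - k%:R * a).

Definition ml_remainder (R : realType) (N : nat) (a lam t : R) : R :=
  mittag_leffler a (- (lam * t `^ a)) -
  \sum_(1 <= k < N.+1) ml_coef k a * lam ^- k * t `^ (- (k%:R * a)).

(* Main.v *)
Require Import Defs.
From HB Require Import structures.
From mathcomp Require Import all_boot all_order all_algebra.
From mathcomp Require Import all_classical all_reals all_analysis.
From mathcomp Require Import measurable_realfun complex ring lra.

(** Write q(v) = v^a e^(i pi a) / lam.  For 0 < a < 1 the function has the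
    spectral representation
      E_{a,1}(-lam t^a)
        = 1/pi int_0^oo e^(-t v) Im (q(v) / (1 + q(v))) dv / v,
    in which large t only sees small v, hence small q.  The finite geometric
    expansion
      q / (1 + q) = - sum_(1 <= k <= N) (-q)^k - (-q)^(N+1) / (1 + q)
    is exact.  Its k-th term integrates to a Gamma integral, and the reflection
    formula turns sin (pi k a) Gamma(k a) / pi into 1 / Gamma(1 - k a): this is
    c_k(a) lam^(-k) t^(-k a) ([spectral_remainderB]).  So the remainder of the
    theorem is the integral of the last term ([ml_remainderE]).

    Everything asked of the remainder is read off from this integral.  Since
    |1 + q| >= cos (pi a / 2), its integrand is at most
    e^(-t v) v^((N+1) a - 1) lam^(-(N+1)) / cos (pi a / 2), whose integral is
    Gamma((N+1) a) lam^(-(N+1)) t^(-(N+1) a) / cos (pi a / 2); this is uniform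
    on compact intervals of exponents ([spectral_remainder_le]).  Differentiating in a only multiplies the
    integrand by a factor O(|ln v| + pi), as q depends on a through
    exp (a (ln v + i pi)).  The identity ln v = ln (t v) - ln t then produces
    the factor 1 + ln t ([Rintegral_log_density_le],
    [spectral_remainder_derive_le]).

    The representation ([mittag_leffler_ray]) comes from the Hankel contour,
    which goes around a circle of radius r and along both sides of the negative
    half-line outside it.  By symmetry its upper half suffices: an integral over
    a half-circle plus one over a ray.  The sum does not depend on r
    ([hankel_const]), because the derivative in r of the integral over the arc
    is the integral of an exact derivative in the angle.  For the integrand
    e^(t s) s^(-b) / s the contour yields t^b / Gamma(1 + b)
    ([hankel_Gamma]).  For e^(t s) s^a / (s^a + lam) / s there are two ways of
    computing it.  On a circle where |s|^a = 2 lam the geometric series of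
    s^a / (s^a + lam) converges, and gives the Mittag-Leffler series term by
    term.  When the circle shrinks to the origin, only the ray is left, and it
    carries the spectral integral.

    The reflection formula is proved on the interval (0, 1).  There
    Gamma(z) Gamma(1 - z) is the integral B(z) of v^(z-1) / (1 + v)
    ([Gamma_mul_Gamma]), and a contour in the first quadrant shows
    2 sin (pi z / 2) B(z) = B((1 + z) / 2) ([beta_integral_duplication]).  Thus
    Gamma(z) Gamma(1 - z) sin (pi z) / pi is unchanged when z moves to
    (1 + z) / 2.  Iterating drives z to 1, where this expression tends to 1. *)

Import Order.TTheory GRing.Theory Num.Theory.
Import numFieldNormedType.Exports.

Local Open Scope classical_set_scope.
Local Open Scope ring_scope.

Set Implicit Arguments.
Unset Strict Implicit.

(** * Integrals over the half-line *)

Section half_line.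
Context {R : realType}.
Notation mu := (@lebesgue_measure R).

Lemma integrable_itvZ (i : interval R) (k : R) (f : R -> R) :
  mu.-integrable [set` i] (EFin \o f) ->
  mu.-integrable [set` i] (EFin \o (fun v => k * f v)).
Proof.
move=> h; rewrite (_ : _ \o _ = (fun v : R => k%:E * (f v)%:E)%E).
  by apply: integrableZl => //; exact: measurable_itv.
by apply/funext => v; rewrite /= EFinM.
Qed.

Lemma integrable_itvD (i : interval R) (f g : R -> R) :
  mu.-integrable [set` i] (EFin \o f) -> mu.-integrable [set` i] (EFin \o g) ->
  mu.-integrable [set` i] (EFin \o (fun v => f v + g v)).
Proof.
move=> hf hg; rewrite (_ : _ \o _ = (fun v : R => (f v)%:E + (g v)%:E)%E).
  by apply: integrableD => //; exact: measurable_itv.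
by apply/funext => v; rewrite /= EFinD.
Qed.

Lemma integrable_itvB (i : interval R) (f g : R -> R) :
  mu.-integrable [set` i] (EFin \o f) -> mu.-integrable [set` i] (EFin \o g) ->
  mu.-integrable [set` i] (EFin \o (fun v => f v - g v)).
Proof.
move=> hf hg; rewrite (_ : _ \o _ = (fun v : R => (f v)%:E - (g v)%:E)%E).
  by apply: integrableB => //; exact: measurable_itv.
by apply/funext => v; rewrite /= EFinB.
Qed.

(** Dominated convergence for the truncations of f to the sets Dn, with |f| as
    the dominating function. *)
Lemma Rintegral_exhaust (D : set R) (Dn : nat -> set R) (f : R -> R) :
  measurable D -> (forall n, measurable (Dn n)) -> (forall n, Dn n `<=` D) ->
  (forall x, D x -> \forall n \near \oo, Dn n x) ->
  mu.-integrable D (EFin \o f) ->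
  \int[mu]_(x in Dn n) f x @[n --> \oo] --> \int[mu]_(x in D) f x.
Proof.
move=> mD mDn DnD Dx intf.
have E n : \int[mu]_(x in Dn n) f x = \int[mu]_(x in D) (f \_ (Dn n)) x.
  rewrite -Rintegral_mkcondr; congr (Rintegral _ _ _).
  by rewrite setIC; apply/esym/setIidl/DnD.
under eq_fun do rewrite E.
apply: fine_cvg.
rewrite fineK; last exact: integrable_fin_num.
have mf : measurable_fun D f by apply/measurable_EFinP; case/integrableP: intf.
have [] // := @dominated_convergence _ _ _ mu _ mD
  (fun n x => ((f \_ (Dn n)) x)%:E) (EFin \o f) (fun x => `|f x|%:E).
- move=> n; apply/measurable_EFinP.
  apply/(measurable_restrict _ (mDn n) mD).
  by apply: measurable_funS mf => //; exact: subIsetl.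
- by apply/measurable_EFinP.
- apply: aeW => x Dx'.
  have [N _ HN] := Dx x Dx'.
  apply: cvg_near_cst; exists N => // n Nn /=.
  by rewrite patchE mem_set//; exact: HN.
- exact: integrable_norm.
- apply: aeW => x n Dx' /=; rewrite lee_fin patchE.
  by case: ifP => _ //; rewrite normr0.
Qed.

Lemma is_derive_continuous (f : R -> R) (x d : R) :
  is_derive x 1 f d -> {for x, continuous f}.
Proof.
by move=> [df _]; apply: differentiable_continuous; apply/derivable1_diffP.
Qed.

Lemma within_itvcc_continuous (f : R -> R) (a b : R) :
  (forall x, a <= x <= b -> {for x, continuous f}) ->
  {within `[a, b], continuous f}.
Proof.
move=> cf; apply: continuous_in_subspaceT => x.
by rewrite inE /= in_itv /=; exact: cf.
Qed.

Lemma integrable_itvcc (f : R -> R) (a b : R) :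
  (forall x, a <= x <= b -> {for x, continuous f}) ->
  mu.-integrable `[a, b] (EFin \o f).
Proof.
move=> cf; apply: continuous_compact_integrable.
  exact: segment_compact.
exact: within_itvcc_continuous.
Qed.

Lemma Rintegral_FTC2 (f F : R -> R) (a b : R) : a <= b ->
  (forall x, a <= x <= b -> is_derive x 1 F (f x)) ->
  (forall x, a <= x <= b -> {for x, continuous f}) ->
  \int[mu]_(x in `[a, b]) f x = F b - F a.
Proof.
rewrite le_eqVlt => /predU1P[<- _ _|ab dF cf].
  by rewrite set_itv1 Rintegral_set1 subrr.
have cF : {within `[a, b], continuous F}.
  apply: within_itvcc_continuous => x xab; exact: is_derive_continuous (dF x xab).
have oc x : x \in `]a, b[ -> a <= x <= b.
  by rewrite in_itv /= => /andP[/ltW-> /ltW->].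
rewrite /Rintegral (@continuous_FTC2 _ f F)//.
- exact: within_itvcc_continuous.
- move/(continuous_within_itvP _ ab) : cF => [_ Fa Fb]; split => //.
  by move=> x /oc /dF[].
- by move=> x /oc /dF h; rewrite derive1E; apply: derive_val.
Qed.

Lemma Rintegral_FTC2y (f F : R -> R) (a l : R) :
  (forall x, a <= x -> is_derive x 1 F (f x)) ->
  (forall x, a <= x -> {for x, continuous f}) ->
  mu.-integrable `[a, +oo[ (EFin \o f) ->
  F x @[x --> +oo] --> l ->
  \int[mu]_(x in `[a, +oo[) f x = l - F a.
Proof.
move=> dF cf intf Fl.
have h1 : \int[mu]_(x in `[a, (a + n%:R)]) f x @[n --> \oo] -->
          \int[mu]_(x in `[a, +oo[) f x.
  apply: Rintegral_exhaust => //.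
  - by move=> n x /=; rewrite !in_itv /= => /andP[->].
  - move=> x /=; rewrite in_itv /= andbT => ax; near=> n.
    rewrite in_itv /= ax /= -lerBlDl.
    by near: n; exact: nbhs_infty_ger.
have h2 : F (a + n%:R) - F a @[n --> \oo] --> l - F a.
  apply: cvgB; last exact: cvg_cst.
  apply: (cvg_comp _ _ _ Fl) => /=.
  apply/cvgryPge => r; near=> n; rewrite -lerBlDl.
  by near: n; exact: nbhs_infty_ger.
apply: cvg_unique h1 _ => //.
rewrite (_ : (fun n => _) = (fun n : nat => F (a + n%:R) - F a))//.
apply/funext => n; apply: Rintegral_FTC2.
- by rewrite lerDl.
- by move=> x /andP[/dF].
- by move=> x /andP[/cf].
Unshelve. all: by end_near. Qed.

Lemma invn_gt0 n : 0 < n.+1%:R^-1 :> R. Proof. by rewrite invr_gt0. Qed.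

Lemma cvg_invn_at_right0 : (n.+1%:R^-1 : R) @[n --> \oo] --> (0 : R)^'+.
Proof.
move=> A /= [e e0 Ae].
suff: \forall n \near \oo, A (n.+1%:R^-1) by [].
near=> n; apply: Ae => /=; last exact: invn_gt0.
rewrite sub0r normrN gtr0_norm ?invn_gt0//.
by near: n; exact: near_infty_natSinv_lt (PosNum e0).
Unshelve. all: by end_near. Qed.

Lemma near_invn_le (x : R) : 0 < x -> \forall n \near \oo, n.+1%:R^-1 <= x.
Proof.
move=> x0; near=> n; apply: ltW.
by near: n; exact: near_infty_natSinv_lt (PosNum x0).
Unshelve. all: by end_near. Qed.

Lemma cvg_Rintegral_invn_y (f : R -> R) :
  mu.-integrable `]0, +oo[ (EFin \o f) ->
  \int[mu]_(x in `[n.+1%:R^-1, +oo[) f x @[n --> \oo] -->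
  \int[mu]_(x in `]0, +oo[) f x.
Proof.
move=> intf; apply: Rintegral_exhaust => //.
- move=> n x /=; rewrite !in_itv /= !andbT; apply: lt_le_trans; exact: invn_gt0.
- move=> x /=; rewrite in_itv /= andbT => /near_invn_le.
  by apply: filterS => n; rewrite in_itv /= andbT.
Qed.

Lemma Rintegral_FTC2_pos (f F : R -> R) (l0 l : R) :
  (forall x : R, 0 < x -> is_derive x 1 F (f x)) ->
  (forall x : R, 0 < x -> {for x, continuous f}) ->
  mu.-integrable `]0, +oo[ (EFin \o f) ->
  F x @[x --> (0 : R)^'+] --> l0 ->
  F x @[x --> +oo] --> l ->
  \int[mu]_(x in `]0, +oo[) f x = l - l0.
Proof.
move=> dF cf intf Fl0 Fl.
have h1 := cvg_Rintegral_invn_y intf.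
have h2 : l - F n.+1%:R^-1 @[n --> \oo] --> l - l0.
  apply: cvgB; first exact: cvg_cst.
  by apply: (cvg_comp _ _ _ Fl0); exact: cvg_invn_at_right0.
apply: cvg_unique h1 _ => //.
rewrite (_ : (fun n => _) = (fun n : nat => l - F n.+1%:R^-1))//.
apply/funext => n; apply: Rintegral_FTC2y => //.
- by move=> x /(lt_le_trans (invn_gt0 n)) /dF.
- by move=> x /(lt_le_trans (invn_gt0 n)) /cf.
- apply: integrableS intf => // x /=; rewrite !in_itv /= !andbT.
  exact: lt_le_trans (invn_gt0 n).
Qed.

Lemma invn_le_n n : n.+1%:R^-1 <= n.+1%:R :> R.
Proof. by rewrite (@le_trans _ _ 1) ?ler1n// invf_le1// ler1n. Qed.

Lemma cvg_Rintegral_invn_n (f : R -> R) :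
  mu.-integrable `]0, +oo[ (EFin \o f) ->
  \int[mu]_(x in `[n.+1%:R^-1, n.+1%:R]) f x @[n --> \oo] -->
  \int[mu]_(x in `]0, +oo[) f x.
Proof.
move=> intf; apply: Rintegral_exhaust => //.
- move=> n x; rewrite /= !in_itv /= andbT => /andP[+ _].
  by apply: lt_le_trans; exact: invn_gt0.
- move=> x /=; rewrite in_itv /= andbT => x0.
  near=> n; rewrite in_itv /=; apply/andP; split.
    by near: n; exact: near_invn_le.
  apply: (@le_trans _ _ n%:R); last by rewrite ler_nat.
  by near: n; exact: nbhs_infty_ger.
Unshelve. all: by end_near. Qed.

Lemma measurable_pos (f : R -> R) :
  (forall x : R, 0 < x -> {for x, continuous f}) -> measurable_fun (`]0, +oo[ : set R) f.
Proof.
move=> cf; apply: open_continuous_measurable_fun; first exact: interval_open.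
by move=> x; rewrite inE /= in_itv /= andbT; exact: cf.
Qed.

Lemma integrable_pos_le (f g : R -> R) :
  (forall x : R, 0 < x -> {for x, continuous f}) ->
  (forall x : R, 0 < x -> `|f x| <= g x) ->
  mu.-integrable `]0, +oo[ (EFin \o g) ->
  mu.-integrable `]0, +oo[ (EFin \o f).
Proof.
move=> cf fg; apply: le_integrable => //.
  by apply/measurable_EFinP; exact: measurable_pos.
move=> x /=; rewrite in_itv /= andbT => x0.
by rewrite lee_fin (le_trans (fg _ x0))// ler_norm.
Qed.

(** A bounded primitive bounds the integrals over all compact subintervals, and
    monotone convergence passes the bound to the half-line. *)
Lemma integrable_pos_primitive (f F : R -> R) (m M : R) :
  (forall x : R, 0 < x -> is_derive x 1 F (f x)) ->
  (forall x : R, 0 < x -> {for x, continuous f}) ->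
  (forall x : R, 0 < x -> 0 <= f x) ->
  (forall x : R, 0 < x -> m <= F x <= M) ->
  mu.-integrable `]0, +oo[ (EFin \o f).
Proof.
move=> dF cf f0 FM.
have mf := measurable_pos cf.
pose Dn n := `[n.+1%:R^-1, n.+1%:R]%classic : set R.
have Dn0 n x : Dn n x -> 0 < x.
  by rewrite /Dn /= in_itv /= => /andP[/(lt_le_trans (invn_gt0 n))].
have UD : \bigcup_n Dn n = `]0, +oo[%classic :> set R.
  apply/seteqP; split => x /=.
    by move=> [n _ /Dn0]; rewrite in_itv /= andbT.
  rewrite in_itv /= andbT => x0.
  near \oo => n; exists n => //; rewrite /Dn /= in_itv /=; apply/andP; split.
    by near: n; exact: near_invn_le.
  apply: (@le_trans _ _ n%:R); last by rewrite ler_nat.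
  by near: n; exact: nbhs_infty_ger.
have DS n : Dn n `<=` `]0, +oo[%classic.
  by move=> x /Dn0; rewrite /= in_itv /= andbT.
apply/integrableP; split; first exact/measurable_EFinP.
have h : (\int[mu]_(x in Dn n) `|(f x)%:E| @[n --> \oo] -->
          \int[mu]_(x in \bigcup_n Dn n) `|(f x)%:E|)%E.
  apply: ge0_nondecreasing_set_cvg_integral.
  - move=> n k nk; apply/subsetPset => x; rewrite /Dn /= !in_itv /= => /andP[h1 h2].
    rewrite (le_trans _ h1) ?(le_trans h2)//= ?ler_nat//.
    by rewrite lef_pV2 ?posrE// ler_nat.
  - by move=> n; exact: measurable_itv.
  - move=> n; apply: measurableT_comp => //; apply/measurable_EFinP.
    by apply: measurable_funS mf => //; exact: DS.
  - by move=> *; exact: abse_ge0.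
rewrite -UD -(cvg_lim _ h)//.
apply: (@le_lt_trans _ _ (M - m)%:E); last exact: ltry.
apply: lime_le; first by apply/cvg_ex; eexists; exact: h.
near=> n.
have int_n : mu.-integrable (Dn n) (EFin \o f).
  by apply: integrable_itvcc => x /Dn0; exact: cf.
have ab := invn_le_n n.
have -> : (\int[mu]_(x in Dn n) `|(f x)%:E| = (\int[mu]_(x in Dn n) f x)%:E)%E.
  rewrite /Rintegral fineK; last by apply: integrable_fin_num => //; exact: measurable_itv.
  by apply: eq_integral => x; rewrite inE => /Dn0 /f0 fx0; rewrite gee0_abs ?lee_fin.
have -> : \int[mu]_(x in Dn n) f x = F n.+1%:R - F n.+1%:R^-1.
  apply: Rintegral_FTC2 => // x /andP[/(lt_le_trans (invn_gt0 n)) x0 _].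
    exact: dF.
  exact: cf.
have /FM/andP[? ?] := invn_gt0 n; have /FM/andP[? ?] := ltr0Sn R n.
by rewrite lee_fin; lra.
Unshelve. all: by end_near. Qed.

(** Substitution on the compact intervals [1/n, n]; their images under h exhaust
    the half-line as well, so both sides converge. *)
Lemma Rintegral_pos_subst (f h h' : R -> R) :
  (forall x : R, 0 < x -> is_derive x 1 h (h' x)) ->
  (forall x : R, 0 < x -> {for x, continuous h'}) ->
  (forall x : R, 0 < x -> 0 < h x) ->
  (forall x y : R, 0 < x -> x < y -> h x < h y) ->
  h x @[x --> (0:R)^'+] --> 0 -> h x @[x --> +oo] --> +oo ->
  (forall x : R, 0 < x -> {for x, continuous f}) ->
  mu.-integrable `]0, +oo[ (EFin \o f) ->
  mu.-integrable `]0, +oo[ (EFin \o (fun x => f (h x) * h' x)) ->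
  \int[mu]_(x in `]0, +oo[) f x = \int[mu]_(x in `]0, +oo[) (f (h x) * h' x).
Proof.
move=> dh ch' h0 mono hl0 hly cf intf intfh.
have ch x : 0 < x -> {for x, continuous h} by move=> /dh /is_derive_continuous.
pose In n := `[n.+1%:R^-1, n.+1%:R]%classic : set R.
have h1 : \int[mu]_(x in In n) (f (h x) * h' x) @[n --> \oo] -->
          \int[mu]_(x in `]0, +oo[) (f (h x) * h' x).
  exact: cvg_Rintegral_invn_n intfh.
have h2 : \int[mu]_(x in `[h n.+1%:R^-1, h n.+1%:R]) f x @[n --> \oo] -->
          \int[mu]_(x in `]0, +oo[) f x.
  apply: Rintegral_exhaust => //.
  - move=> n x; rewrite /= !in_itv /= andbT => /andP[+ _].
    by apply: lt_le_trans; apply: h0; exact: invn_gt0.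
  - move=> x /=; rewrite in_itv /= andbT => x0.
    near=> n; rewrite in_itv /=; apply/andP; split.
      near: n; have /cvgr_le/(_ _ x0) := hl0.
      exact: cvg_invn_at_right0.
    near: n; have /cvgryPge/(_ x) := hly.
    apply: (_ : (n.+1%:R : R) @[n --> \oo] --> +oo).
    apply/cvgryPge => r; near=> n.
    apply: (@le_trans _ _ n%:R); last by rewrite ler_nat.
    by near: n; exact: nbhs_infty_ger.
apply: cvg_unique h2 _ => //.
rewrite (_ : (fun n => _) = (fun n => \int[mu]_(x in In n) (f (h x) * h' x)))//.
apply/funext => n; have n0 := invn_gt0 n.
have ab := invn_le_n n.
have dhE (x : R) : 0 < x -> (derive1 h) x = h' x.
  by move=> /dh [_ <-]; rewrite derive1E.
have nhE (x : R) : 0 < x -> \forall y \near x, h' y = (derive1 h) y.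
  move=> x0; near=> y; apply/esym/dhE; near: y; exact: lt_nbhsr.
have ch1 (x : R) : 0 < x -> {for x, continuous (derive1 h)}.
  move=> x0; rewrite /prop_for /continuous_at dhE//.
  by apply: cvg_trans (ch' _ x0); apply: near_eq_cvg; exact: nhE.
rewrite /Rintegral integration_by_substitution_increasing//.
- congr fine; apply: eq_integral => x; rewrite inE /= in_itv /= => /andP[+ _].
  by move=> /(lt_le_trans n0) /dhE; rewrite !fctE => ->.
- move=> x y; rewrite !in_itv /= => /andP[/(lt_le_trans n0) x0 _] _; exact: mono.
- by move=> x; rewrite in_itv /= => /andP[/(lt_trans n0) + _]; exact: ch1.
- by apply/cvg_ex; eexists; apply: cvg_at_right_filter; exact: ch1.
- by apply/cvg_ex; eexists; apply: cvg_at_left_filter; exact: ch1.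
- split.
  + by move=> x; rewrite in_itv /= => /andP[/(lt_trans n0)/dh[]].
  + by apply: cvg_at_right_filter; exact: ch.
  + by apply: cvg_at_left_filter; exact: ch.
- apply: within_itvcc_continuous => x /andP[+ _] => /(lt_le_trans (h0 _ n0)).
  exact: cf.
Unshelve. all: by end_near. Qed.
End half_line.

(** * Complex-valued functions of a real variable *)

Section complex_derivative.
Import ComplexField.Normc.
Local Open Scope complex_scope.
Context {R : realType}.
Local Notation Re := (@complex.Re R).
Local Notation Im := (@complex.Im R).
Implicit Types (z w : R[i]) (f g : R -> R[i]).

Definition cexp z : R[i] :=
  (expR (Re z) * cos (Im z)) +i* (expR (Re z) * sin (Im z)).

Lemma ReD z w : Re (z + w) = Re z + Re w. Proof. by case: z w => [? ?] []. Qed.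
Lemma ImD z w : Im (z + w) = Im z + Im w. Proof. by case: z w => [? ?] []. Qed.
Lemma ReN z : Re (- z) = - Re z. Proof. by case: z. Qed.
Lemma ImN z : Im (- z) = - Im z. Proof. by case: z. Qed.
Lemma ReM z w : Re (z * w) = Re z * Re w - Im z * Im w.
Proof. by case: z w => [? ?] []. Qed.
Lemma ImM z w : Im (z * w) = Re z * Im w + Im z * Re w.
Proof. by case: z w => [? ?] []. Qed.

Lemma cexpD z w : cexp (z + w) = cexp z * cexp w.
Proof.
rewrite /cexp ReD ImD expRD cosD sinD; apply/eqP; rewrite eq_complex ReM ImM /=.
by apply/andP; split; apply/eqP; ring.
Qed.

Lemma cexp0 : cexp 0 = 1.
Proof. by rewrite /cexp /= expR0 cos0 sin0 mulr0 mulr1. Qed.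

Lemma normc_cexp z : normc (cexp z) = expR (Re z).
Proof.
rewrite /normc /cexp !exprMn -mulrDr cos2Dsin2 mulr1 sqrtr_sqr ger0_norm// expR_ge0.
Qed.

Lemma normc_ge0 z : 0 <= normc z. Proof. by case: z => a b; exact: sqrtr_ge0. Qed.

Lemma Re_le_normc z : `|Re z| <= normc z.
Proof.
case: z => a b /=; rewrite -sqrtr_sqr ler_sqrt ?addr_ge0 ?sqr_ge0//.
by rewrite lerDl sqr_ge0.
Qed.

Lemma Im_le_normc z : `|Im z| <= normc z.
Proof.
case: z => a b /=; rewrite -sqrtr_sqr ler_sqrt ?addr_ge0 ?sqr_ge0//.
by rewrite lerDr sqr_ge0.
Qed.

Lemma normcD z w : normc (z + w) <= normc z + normc w.
Proof. by have /andP[] := ComplexField.lec_normD z w. Qed.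

Lemma normcN z : normc (- z) = normc z.
Proof. by case: z => a b /=; rewrite !sqrrN. Qed.

Lemma normcX z n : normc (z ^+ n) = normc z ^+ n.
Proof.
elim: n => [|n IH]; first by rewrite !expr0 normc1.
by rewrite !exprS normcM IH.
Qed.

Lemma normc_real (x : R) : normc x%:C = `|x|.
Proof. by rewrite /normc /= expr0n addr0 sqrtr_sqr. Qed.

Lemma sqr_normc z : normc z ^+ 2 = Re z ^+ 2 + Im z ^+ 2.
Proof. by case: z => a b /=; rewrite sqr_sqrtr// addr_ge0 ?sqr_ge0. Qed.

Lemma normc_le_Im z : normc z <= `|Re z| + `|Im z|.
Proof.
have h : 0 <= `|Re z| + `|Im z| by rewrite addr_ge0.
rewrite -(ler_pXn2r (n:=2))// ?nnegrE ?normc_ge0// sqr_normc sqrrD.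
rewrite !real_normK ?num_real//; have : 0 <= `|Re z| * `|Im z| by rewrite mulr_ge0.
lra.
Qed.

(** Differentiability of a curve in the complex plane, kept componentwise so
    that the real and imaginary parts of a complex integrand can be fed to real
    integration theorems without further work. *)
Definition is_cderive f (x : R) (d : R[i]) : Prop :=
  is_derive x 1 (Re \o f) (Re d) /\ is_derive x 1 (Im \o f) (Im d).

Lemma is_cderive_eq f x d d' : is_cderive f x d -> d = d' -> is_cderive f x d'.
Proof. by move=> ? <-. Qed.

Lemma is_cderive_cst z x : is_cderive (fun=> z) x 0.
Proof. by split; exact: is_derive_cst. Qed.

Lemma is_cderiveD f g x d e : is_cderive f x d -> is_cderive g x e ->
  is_cderive (fun y => f y + g y) x (d + e).
Proof.
move=> [fr fi] [gr gi]; split.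
  rewrite (_ : _ \o _ = (Re \o f) + (Re \o g)); last first.
    by apply/funext => y; rewrite /= ReD.
  by rewrite ReD; exact: is_deriveD.
rewrite (_ : _ \o _ = (Im \o f) + (Im \o g)); last first.
  by apply/funext => y; rewrite /= ImD.
by rewrite ImD; exact: is_deriveD.
Qed.

Lemma is_cderiveM f g x d e : is_cderive f x d -> is_cderive g x e ->
  is_cderive (fun y => f y * g y) x (d * g x + f x * e).
Proof.
move=> [fr fi] [gr gi]; split.
  rewrite (_ : _ \o _ = (Re \o f) * (Re \o g) - (Im \o f) * (Im \o g)); last first.
    by apply/funext => y; rewrite /= ReM.
  apply: is_derive_eq; rewrite /= ReD !ReM /GRing.scale /=; ring.
rewrite (_ : _ \o _ = (Re \o f) * (Im \o g) + (Im \o f) * (Re \o g)); last first.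
  by apply/funext => y; rewrite /= ImM.
apply: (is_derive_eq (is_deriveD (is_deriveM fr gi) (is_deriveM fi gr))).
rewrite /= ImD !ImM /GRing.scale /=; ring.
Qed.

Lemma is_cderive_real (f : R -> R) (x d : R) : is_derive x 1 f d ->
  is_cderive (fun y => (f y)%:C) x d%:C.
Proof. by move=> h; split => //; exact: is_derive_cst. Qed.

Lemma is_cderive_exp f x d : is_cderive f x d ->
  is_cderive (fun y => cexp (f y)) x (d * cexp (f x)).
Proof.
move=> [fr fi]; split.
  rewrite (_ : _ \o _ = (expR \o (Re \o f)) * (cos \o (Im \o f)))//.
  apply: is_derive_eq; rewrite /= ReM /GRing.scale /=; ring.
rewrite (_ : _ \o _ = (expR \o (Re \o f)) * (sin \o (Im \o f)))//.
apply: is_derive_eq; rewrite /= ImM /GRing.scale /=; ring.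
Qed.

Lemma ReV z : Re (z^-1) = Re z / (Re z ^+ 2 + Im z ^+ 2). Proof. by case: z. Qed.
Lemma ImV z : Im (z^-1) = - (Im z / (Re z ^+ 2 + Im z ^+ 2)). Proof. by case: z. Qed.

Lemma is_cderiveV f x d : f x != 0 -> is_cderive f x d ->
  is_cderive (fun y => (f y)^-1) x (- (d / f x ^+ 2)).
Proof.
move=> fx0 [fr fi].
have n0 : Re (f x) ^+ 2 + Im (f x) ^+ 2 != 0.
  rewrite -sqr_normc sqrf_eq0; apply: contra fx0 => /eqP/eq0_normc ->//.
pose n2 : R -> R := (Re \o f) * (Re \o f) + (Im \o f) * (Im \o f).
have dn2 : is_derive x 1 n2 (2 * Re (f x) * Re d + 2 * Im (f x) * Im d).
  apply: (is_derive_eq (is_deriveD (is_deriveM fr fr) (is_deriveM fi fi))).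
  rewrite /GRing.scale /=; ring.
have dn : is_derive x 1 (fun y => (n2 y)^-1)
    (- n2 x ^- 2 *: (2 * Re (f x) * Re d + 2 * Im (f x) * Im d)).
  exact: is_deriveV.
have n2E : n2 x = Re (f x) ^+ 2 + Im (f x) ^+ 2 by rewrite !expr2.
have fx2 : (Re (f x) * Re (f x) - Im (f x) * Im (f x)) ^+ 2 +
    (Re (f x) * Im (f x) + Im (f x) * Re (f x)) ^+ 2 =
    (Re (f x) ^+ 2 + Im (f x) ^+ 2) ^+ 2 by ring.
split.
  rewrite (_ : _ \o _ = (Re \o f) * (fun y => (n2 y)^-1)); last first.
    by apply/funext => y; rewrite /= ReV.
  apply: is_derive_eq; rewrite /= ReN ReM ReV ImV [f x ^+ 2]expr2 ReM ImM /GRing.scale /=.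
  rewrite fx2 n2E; move: n0; move: (Re (f x)) (Im (f x)) (Re d) (Im d) => a b c e n0.
  by field.
rewrite (_ : _ \o _ = (- (Im \o f)) * (fun y => (n2 y)^-1)); last first.
  by apply/funext => y; rewrite /= ImV -mulNr.
apply: is_derive_eq; rewrite /= fctE ImN ImM ReV ImV [f x ^+ 2]expr2 ReM ImM /GRing.scale /=.
rewrite fx2 n2E; move: n0; move: (Re (f x)) (Im (f x)) (Re d) (Im d) => a b c e n0.
by field.
Qed.

Lemma is_cderive_Re f x d : is_cderive f x d ->
  is_derive x 1 (fun y => Re (f y)) (Re d).
Proof. by case. Qed.

Lemma is_cderive_Im f x d : is_cderive f x d ->
  is_derive x 1 (fun y => Im (f y)) (Im d).
Proof. by case. Qed.

(** The logarithm of the point v e^(i th).  Working with the logarithm as the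
    variable makes every power s^x the single-valued function cexp (x * log s), on
    both sides of the negative half-line as well. *)
Definition log_polar (v th : R) : R[i] := ln v +i* th.

Lemma is_cderive_log_polar_radius (v th : R) : 0 < v ->
  is_cderive (fun u => log_polar u th) v (v^-1)%:C.
Proof.
move=> v0; split; last exact: is_derive_cst.
exact: is_derive1_ln.
Qed.

Lemma is_cderive_log_polar_angle (v th : R) :
  is_cderive (fun t => log_polar v t) th 'i.
Proof. by split => /=; [exact: is_derive_cst|exact: is_derive_id]. Qed.

End complex_derivative.

(** * The integral theorem on a sector *)

Section sector_contour.
Import ComplexField.Normc.
Local Open Scope complex_scope.
Context {R : realType}.
Local Notation Re := (@complex.Re R).
Local Notation Im := (@complex.Im R).
Notation mu := (@lebesgue_measure R).

(** Complex differentiability in the form in which contours use it: along every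
    curve through D the chain rule holds, with the same complex number dF as
    factor.  Applied to rays and to circles it yields the Cauchy-Riemann
    equations. *)
Definition curve_holo (D : set R[i]) (F dF : R[i] -> R[i]) : Prop :=
  forall (p : R -> R[i]) (x : R) (d : R[i]), D (p x) ->
    is_cderive p x d -> is_cderive (F \o p) x (d * dF (p x)).

(** The logarithms of the points of the sector 0 <= arg s <= phi. *)
Definition strip (phi : R) : set R[i] := [set w | 0 <= Im w <= phi].

Definition arc_integral (F : R[i] -> R[i]) (phi v : R) : R :=
  \int[mu]_(th in `[0, phi]) Re (F (log_polar v th)).

Section radial_derivative.
Variables (phi : R) (F dF ddF : R[i] -> R[i]).
Hypothesis phi0 : 0 <= phi.
Hypothesis hF : curve_holo (strip phi) F dF.
Hypothesis hdF : curve_holo (strip phi) dF ddF.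
Hypothesis bdF : forall a b : R, 0 < a -> exists M : R, forall v th : R,
  a <= v <= b -> 0 <= th <= phi -> normc (dF (log_polar v th)) <= M.

Let dF_angle (v th : R) : 0 <= th <= phi ->
  is_cderive (fun t => F (log_polar v t)) th ('i * dF (log_polar v th)).
Proof. by move=> thphi; apply: hF => //; exact: is_cderive_log_polar_angle. Qed.

Let ddF_angle (v th : R) : 0 <= th <= phi ->
  is_cderive (fun t => dF (log_polar v t)) th ('i * ddF (log_polar v th)).
Proof. by move=> thphi; apply: hdF => //; exact: is_cderive_log_polar_angle. Qed.

Let dF_radius (v th : R) : 0 < v -> 0 <= th <= phi ->
  is_cderive (fun u => F (log_polar u th)) v ((v^-1)%:C * dF (log_polar v th)).
Proof. by move=> v0 thphi; apply: hF => //; exact: is_cderive_log_polar_radius. Qed.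

Lemma arc_integral_derive (v : R) : 0 < v ->
  \int[mu]_(th in `[0, phi]) Re (dF (log_polar v th)) =
  Im (F (log_polar v phi)) - Im (F (log_polar v 0)).
Proof.
move=> v0.
apply: (@Rintegral_FTC2 _ _ (fun th => Im (F (log_polar v th)))) => // th thphi.
  have := is_cderive_Im (dF_angle v thphi).
  by rewrite ImM /= mul0r mul1r add0r.
exact: is_derive_continuous (is_cderive_Re (ddF_angle v thphi)).
Qed.

(** In the variables log v and th, the derivatives of F in these directions are
    F' and i F'.  So the derivative in v of the integral of Re F over the arc is 1/v
    times the integral of Re F', which is the derivative of Im F in the angle and
    integrates to boundary values. *)
Lemma is_derive_arc_integral (v : R) : 0 < v ->
  is_derive v 1 (arc_integral F phi)
    (v^-1 * (Im (F (log_polar v phi)) - Im (F (log_polar v 0)))).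
Proof.
move=> v0.
have v20 : 0 < v / 2 by rewrite divr_gt0.
have [M HM] := bdF (v * 2) v20.
pose f (u th : R) := Re (F (log_polar u th)).
(* A neighbourhood of v bounded away from 0, on which dF is bounded
   uniformly in the angle. *)
pose I := `](v / 2), (v * 2)[%classic : set R.
have Iv : I v by rewrite /I /= in_itv /=; apply/andP; split; lra.
have Ipos u : I u -> 0 < u.
  by rewrite /I /= in_itv /= => /andP[/(lt_trans v20)].
have df u th : I u -> 0 <= th <= phi ->
    is_derive u 1 (f ^~ th) (u^-1 * Re (dF (log_polar u th))).
  move=> /Ipos u0 thphi; have := is_cderive_Re (dF_radius u0 thphi).
  by rewrite ReM /= mul0r subr0.
have d1f u th : I u -> `[0, phi]%classic th ->
    partial1of2 f u th = u^-1 * Re (dF (log_polar u th)).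
  move=> Iu; rewrite /= in_itv /= => thphi; rewrite partial1of2E.
  by have [_ ->] := df _ _ Iu thphi.
have intf u : I u -> mu.-integrable `[0, phi] (EFin \o f u).
  move=> Iu; apply: integrable_itvcc => th thphi.
  exact: is_derive_continuous (is_cderive_Re (dF_angle u thphi)).
have intdf : mu.-integrable `[0, phi] (EFin \o (fun th => Re (dF (log_polar v th)))).
  apply: integrable_itvcc => th thphi.
  exact: is_derive_continuous (is_cderive_Re (ddF_angle v thphi)).
have derf u th : I u -> `[0, phi]%classic th -> derivable (f ^~ th) u 1.
  by move=> Iu; rewrite /= in_itv /= => thphi; have [] := df _ _ Iu thphi.
have M0 : 0 <= M.
  apply: le_trans (HM v 0 _ _); first exact: normc_ge0.
    by apply/andP; split; lra.
  by rewrite lexx.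
pose G (th : R) := (v / 2)^-1 * M.
have G0 th : 0 <= G th by rewrite /G mulr_ge0// invr_ge0 ltW.
have intG : mu.-integrable `[0, phi] (EFin \o G).
  by apply: integrable_itvcc => th _; exact: cst_continuous.
have Gub u th : I u -> `[0, phi]%classic th -> `|partial1of2 f u th| <= G th.
  move=> Iu thphi; rewrite d1f// normrM ger0_norm; last first.
    by rewrite invr_ge0 ltW// Ipos.
  have := Iu; rewrite /I /= in_itv /= => /andP[u1 u2].
  apply: ler_pM => //; first by rewrite invr_ge0 ltW// Ipos.
    by rewrite lef_pV2 ?posrE ?ltW// Ipos.
  apply: le_trans (Re_le_normc _) _; apply: HM; last by move: thphi; rewrite /= in_itv.
  by rewrite !ltW.
have mB : measurable (`[0, phi]%classic : set (measurableTypeR R)).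
  exact: measurable_itv.
split.
  have h := (derivable_under_integral mB Iv intf derf G0 intG Gub).
  exact: h.
rewrite -derive1E (differentiation_under_integral mB Iv intf derf G0 intG Gub).
rewrite -arc_integral_derive// -RintegralZl//.
by apply: eq_Rintegral => th; rewrite inE => thphi; rewrite -d1f.
Qed.

(** Cauchy's integral theorem for a circular sector with the corner cut off, for
    the real part of F in the measure d th and its imaginary part in dv / v. *)
Lemma arc_integralB (a b : R) : 0 < a -> a <= b ->
  arc_integral F phi b - arc_integral F phi a =
  \int[mu]_(v in `[a, b]) (v^-1 * (Im (F (log_polar v phi)) - Im (F (log_polar v 0)))).
Proof.
move=> a0 ab; apply/esym; apply: Rintegral_FTC2 => // v /andP[/(lt_le_trans a0) v0 _].
  exact: is_derive_arc_integral.
have cF th : 0 <= th <= phi -> {for v, continuous (fun u => Im (F (log_polar u th)))}.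
  by move=> /(dF_radius v0)/is_cderive_Im/is_derive_continuous.
apply: continuousM; first by apply: inv_continuous; rewrite gt_eqF.
by apply: continuousB; apply: cF; rewrite lexx ?phi0.
Qed.

End radial_derivative.
End sector_contour.

(** * The contour kernel *)

Section kernel.
Import ComplexField.Normc.
Local Open Scope complex_scope.
Context {R : realType}.
Local Notation Re := (@complex.Re R).
Local Notation Im := (@complex.Im R).
Notation mu := (@lebesgue_measure R).
Implicit Types (D : set R[i]) (F G dF dG : R[i] -> R[i]).

Lemma curve_holo_eq D F G dF dG : curve_holo D F dF ->
  F =1 G -> (forall w, D w -> dF w = dG w) -> curve_holo D G dG.
Proof. by move=> hF /funext<- e p x d Dp /(hF _ _ _ Dp); rewrite e. Qed.

Lemma curve_holo_cst D (z : R[i]) : curve_holo D (fun=> z) (fun=> 0).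
Proof. by move=> p x d _ _; rewrite mulr0; exact: is_cderive_cst. Qed.

Lemma curve_holo_id D : curve_holo D id (fun=> 1).
Proof. by move=> p x d _; rewrite mulr1. Qed.

Lemma curve_holoD D F G dF dG : curve_holo D F dF -> curve_holo D G dG ->
  curve_holo D (fun w => F w + G w) (fun w => dF w + dG w).
Proof.
move=> hF hG p x d Dp pd; rewrite mulrDr.
by apply: is_cderiveD; [exact: hF|exact: hG].
Qed.

Lemma curve_holoM D F G dF dG : curve_holo D F dF -> curve_holo D G dG ->
  curve_holo D (fun w => F w * G w) (fun w => dF w * G w + F w * dG w).
Proof.
move=> hF hG p x d Dp pd.
apply: (is_cderive_eq (is_cderiveM (hF _ _ _ Dp pd) (hG _ _ _ Dp pd))) => /=.
by ring.
Qed.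

Lemma curve_holo_exp D F dF : curve_holo D F dF ->
  curve_holo D (fun w => cexp (F w)) (fun w => dF w * cexp (F w)).
Proof.
by move=> hF p x d Dp pd; rewrite mulrA; apply: is_cderive_exp (hF _ _ _ Dp pd).
Qed.

Lemma curve_holoV D F dF : (forall w, D w -> F w != 0) -> curve_holo D F dF ->
  curve_holo D (fun w => (F w)^-1) (fun w => - (dF w / F w ^+ 2)).
Proof.
move=> F0 hF p x d Dp pd.
apply: (is_cderive_eq (is_cderiveV (F0 _ Dp) (hF _ _ _ Dp pd))).
by ring.
Qed.

Lemma curve_holo_scale D (a : R) : curve_holo D (fun w => a%:C * w) (fun=> a%:C).
Proof.
apply: (curve_holo_eq (curve_holoM (curve_holo_cst a%:C) (@curve_holo_id D))) => // w _.
by ring.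
Qed.

Lemma Re_scale (a : R) (w : R[i]) : Re (a%:C * w) = a * Re w.
Proof. by rewrite ReM /= mul0r subr0. Qed.
Lemma Im_scale (a : R) (w : R[i]) : Im (a%:C * w) = a * Im w.
Proof. by rewrite ImM /= mul0r addr0. Qed.

Lemma cos_half_gt0 (psi : R) : 0 <= psi < pi -> 0 < cos (psi / 2).
Proof. by move=> /andP[? ?]; apply: cos_gt0_pihalf; apply/andP; split; lra. Qed.

(** Two vectors whose angle x is at most psi <= pi both have a projection onto
    their bisector of cos (x / 2) times their length, and these projections add
    up. *)
Lemma normc_cexp_add_ge (lam psi : R) (w : R[i]) : 0 <= lam ->
  0 <= Im w <= psi -> psi <= pi ->
  cos (psi / 2) * (expR (Re w) + lam) <= normc (cexp w + lam%:C).
Proof.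
move=> lam0 /andP[w0 wpsi] psipi.
have E0 := expR_gt0 (Re w).
have cpsi : 0 <= cos (psi / 2).
  by apply: cos_ge0_pihalf; apply/andP; split; lra.
have cw : cos psi <= cos (Im w).
  rewrite leNgt ltr_cos ?in_itv /=; last 2 first.
  - by apply/andP; split; lra.
  - by apply/andP; split; lra.
  by rewrite -leNgt.
have c2 : cos psi = 2 * cos (psi / 2) ^+ 2 - 1.
  by rewrite [in LHS](splitr psi) cosD -!expr2 sin2cos2; lra.
rewrite -(ler_pXn2r (n:=2))// ?nnegrE ?normc_ge0 ?mulr_ge0//; last by lra.
rewrite sqr_normc ReD ImD /= addr0 exprMn.
have h : 0 <= (cos (Im w) - cos psi) * (expR (Re w) * lam).
  by rewrite mulr_ge0 ?mulr_ge0 ?subr_ge0// ltW.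
have h2 : 0 <= (1 - cos (psi / 2) ^+ 2) * (expR (Re w) - lam) ^+ 2.
  by rewrite -sin2cos2 -exprMn sqr_ge0.
have h3 := cos2Dsin2 (Im w).
rewrite c2 in h.
rewrite [X in _ <= X](_ : _ = expR (Re w) ^+ 2 * (cos (Im w) ^+ 2 + sin (Im w) ^+ 2)
   + 2 * lam * (expR (Re w) * cos (Im w)) + lam ^+ 2); last by ring.
rewrite h3; move: h h2; move: (cos (psi / 2)) (cos (Im w)) (expR (Re w)) => C x E.
nra.
Qed.

Lemma cexp_add_neq0 (lam psi : R) (w : R[i]) : 0 <= lam ->
  0 <= Im w <= psi -> psi < pi -> cexp w + lam%:C != 0.
Proof.
move=> lam0 wpsi psipi.
have : 0 < normc (cexp w + lam%:C).
  apply: lt_le_trans (normc_cexp_add_ge lam0 wpsi (ltW psipi)).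
  rewrite mulr_gt0 ?cos_half_gt0 ?psipi ?andbT//.
    by case/andP: wpsi; exact: le_trans.
  by rewrite ltr_pwDl// expR_gt0.
by apply: contraTneq => ->; rewrite normc0 ltxx.
Qed.

Section kernel.
Variables (c : R[i]) (t al lam gam : R).

(** With s = cexp w, this is c e^(t s) s^gam / (s^al + lam).  It serves three
    times: with 0 < al < 1 for the Mittag-Leffler function; with al = 0 and lam = 1,
    where the denominator is the constant 2, for Hankel's formula; and with t = 0
    and al = lam = 1 for the beta integral. *)
Definition kernel (w : R[i]) : R[i] :=
  c * cexp (t%:C * cexp w + gam%:C * w) / (cexp (al%:C * w) + lam%:C).

(** The derivative in w, as kernel times logarithmic derivative. *)
Definition dkernel (w : R[i]) : R[i] :=
  kernel w * (t%:C * cexp w + gam%:C -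
    al%:C * cexp (al%:C * w) / (cexp (al%:C * w) + lam%:C)).

Lemma curve_holo_kernel D :
  (forall w, D w -> cexp (al%:C * w) + lam%:C != 0) ->
  curve_holo D kernel dkernel.
Proof.
move=> D0.
have h1 := curve_holo_exp (curve_holoD (curve_holoM (curve_holo_cst t%:C)
  (curve_holo_exp (@curve_holo_id D))) (curve_holo_scale gam)).
have h2 := curve_holoD (curve_holo_exp (curve_holo_scale al)) (curve_holo_cst lam%:C).
have h3 := curve_holoM (curve_holoM (curve_holo_cst c) h1) (curve_holoV D0 (h2 D)).
apply: (curve_holo_eq h3) => // w Dw.
rewrite /dkernel /kernel /=; field; exact: D0.
Qed.

Lemma curve_holo_dkernel D :
  (forall w, D w -> cexp (al%:C * w) + lam%:C != 0) ->
  exists ddF, curve_holo D dkernel ddF.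
Proof.
move=> D0.
have h2 := curve_holoD (curve_holo_exp (curve_holo_scale al)) (curve_holo_cst lam%:C).
have h1 := curve_holo_exp (@curve_holo_id D).
eexists.
apply: (curve_holoM (curve_holo_kernel D0)).
apply: (curve_holoD (F := fun w => t%:C * cexp w + gam%:C)).
  apply: curve_holoD; last exact: curve_holo_cst.
  by apply: curve_holoM h1; exact: curve_holo_cst.
apply: (curve_holo_eq (curve_holoM (curve_holo_cst (-1)) (curve_holoM
  (curve_holoM (curve_holo_cst al%:C)
  (curve_holo_exp (curve_holo_scale (D:=D) al))) (curve_holoV D0 (h2 D))))).
  by move=> w; rewrite mulN1r.
by move=> w _; reflexivity.
Qed.
End kernel.
End kernel.

(** * Size of the kernel on a sector *)

Section kernel_bounds.
Import ComplexField.Normc.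
Local Open Scope complex_scope.
Context {R : realType}.
Local Notation Re := (@complex.Re R).
Local Notation Im := (@complex.Im R).
Notation mu := (@lebesgue_measure R).

Lemma powR_exp (v x : R) : 0 < v -> v `^ x = expR (x * ln v).
Proof. by move=> v0; rewrite /powR gt_eqF. Qed.

Lemma expR_lnK (v : R) : 0 < v -> expR (ln v) = v.
Proof. by move=> v0; rewrite lnK// posrE. Qed.

Lemma Re_cexp_log_polar (v th : R) : 0 < v -> Re (cexp (log_polar v th)) = v * cos th.
Proof. by move=> v0; rewrite /cexp /= expR_lnK. Qed.

Lemma cexp_log_polar (v th : R) : 0 < v -> cexp (log_polar v th) = (v * cos th) +i* (v * sin th).
Proof. by move=> v0; rewrite /cexp /= expR_lnK. Qed.

Lemma normc_kernel (c : R[i]) (t al lam gam v th : R) : 0 < v ->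
  normc (kernel c t al lam gam (log_polar v th)) =
  normc c * (expR (t * (v * cos th)) * v `^ gam) /
  normc (cexp (al%:C * log_polar v th) + lam%:C).
Proof.
move=> v0; rewrite /kernel normcM normcV normcM normc_cexp ReD !Re_scale.
by rewrite Re_cexp_log_polar// expRD powR_exp.
Qed.

Section sector.
Variables (c : R[i]) (phi t al lam gam : R).
Hypotheses (phi0 : 0 <= phi) (t0 : 0 <= t) (al0 : 0 <= al).
Hypotheses (alphi : al * phi < pi) (lam0 : 0 < lam).

Let K := kernel c t al lam gam.
Let m := cos (al * phi / 2).

Let m0 : 0 < m.
Proof. by apply: cos_half_gt0; rewrite alphi mulr_ge0. Qed.

Let im_al (v th : R) : 0 <= th <= phi -> 0 <= Im (al%:C * log_polar v th) <= al * phi.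
Proof.
by move=> /andP[? ?]; rewrite Im_scale /= mulr_ge0//= ler_wpM2l.
Qed.

Lemma kernel_denom_ge (v th : R) : 0 < v -> 0 <= th <= phi ->
  m * (v `^ al + lam) <= normc (cexp (al%:C * log_polar v th) + lam%:C).
Proof.
move=> v0 /(im_al v) h.
have := normc_cexp_add_ge (ltW lam0) h (ltW alphi).
by rewrite Re_scale /= powR_exp.
Qed.

Lemma normc_kernel_le (v th : R) : 0 < v -> 0 <= th <= phi ->
  normc (K (log_polar v th)) <=
  normc c * (expR (t * v) * v `^ gam) / (m * (v `^ al + lam)).
Proof.
move=> v0 thphi; rewrite normc_kernel//.
have d0 : 0 < m * (v `^ al + lam) by rewrite mulr_gt0// ltr_pwDr// powR_ge0.
have h := kernel_denom_ge v0 thphi.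
apply: ler_pM.
- by rewrite mulr_ge0 ?normc_ge0// mulr_ge0 ?powR_ge0 ?expR_ge0.
- by rewrite invr_ge0 normc_ge0.
- rewrite ler_wpM2l ?normc_ge0// ler_wpM2r ?powR_ge0// ler_expR ler_wpM2l//.
  by rewrite ler_piMr ?cos_le1// ltW.
- by rewrite lef_pV2 ?posrE// (lt_le_trans d0).
Qed.

Lemma kernel_denom_neq0 (w : R[i]) : strip phi w -> cexp (al%:C * w) + lam%:C != 0.
Proof.
move=> /andP[w0 wphi]; apply: (@cexp_add_neq0 _ _ (al * phi)) => //; first exact: ltW.
by rewrite Im_scale mulr_ge0//= ler_wpM2l.
Qed.

Lemma dkernel_bounded (a b : R) : 0 < a -> exists M : R, forall v th : R,
  a <= v <= b -> 0 <= th <= phi -> normc (dkernel c t al lam gam (log_polar v th)) <= M.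
Proof.
move=> a0.
exists (normc c * (expR (t * b) * expR (`|gam| * (`|ln a| + `|ln b|))) / (m * lam) *
        (t * b + `|gam| + al / m)) => v th /andP[av vb] thphi.
have v0 := lt_le_trans a0 av.
have b0 := lt_le_trans v0 vb.
rewrite /dkernel normcM; apply: ler_pM; rewrite ?normc_ge0//.
  apply: le_trans (normc_kernel_le v0 thphi) _.
  apply: ler_pM.
  - by rewrite mulr_ge0 ?normc_ge0// mulr_ge0 ?powR_ge0 ?expR_ge0.
  - by rewrite invr_ge0 mulr_ge0// ?ltW// ltr_pwDr// powR_ge0.
  - rewrite ler_wpM2l ?normc_ge0//; apply: ler_pM; rewrite ?expR_ge0 ?powR_ge0//.
      by rewrite ler_expR ler_wpM2l.
    rewrite powR_exp// ler_expR (le_trans (ler_norm _))// normrM ler_wpM2l//.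
    have l1 : ln a <= ln v by rewrite ler_ln ?posrE.
    have l2 : ln v <= ln b by rewrite ler_ln ?posrE.
    rewrite ler_norml; apply/andP; split.
      have := lerNnormlW (lexx `|ln a|); have := normr_ge0 (ln b); lra.
    have := ler_norm (ln b); have := normr_ge0 (ln a); lra.
  - rewrite lef_pV2 ?posrE ?mulr_gt0//; last by rewrite ltr_pwDr// powR_ge0.
    by rewrite ler_wpM2l ?(ltW m0)// lerDr powR_ge0.
apply: le_trans (normcD _ _) _; apply: lerD.
  apply: le_trans (normcD _ _) _; rewrite normc_real lerD2r normcM normc_real.
  by rewrite normc_cexp /= expR_lnK// ger0_norm// ler_wpM2l.
rewrite normcN normcM normcV normcM normc_real normc_cexp Re_scale /= ger0_norm//.
rewrite -powR_exp// -mulrA ler_wpM2l//.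
have d := kernel_denom_ge v0 thphi.
have d0 : 0 < m * (v `^ al + lam) by rewrite mulr_gt0// ltr_pwDr// powR_ge0.
rewrite ler_pdivrMr ?(lt_le_trans d0)// mulrC ler_pdivlMr// mulrC.
apply: le_trans d; rewrite ler_wpM2l ?(ltW m0)// lerDl; exact: ltW.
Qed.

Lemma arc_integral_kernelB (a b : R) : 0 < a -> a <= b ->
  arc_integral K phi b - arc_integral K phi a =
  \int[mu]_(v in `[a, b]) (v^-1 * (Im (K (log_polar v phi)) - Im (K (log_polar v 0)))).
Proof.
have h1 := curve_holo_kernel c t gam kernel_denom_neq0.
have [ddF h2] := curve_holo_dkernel c t gam kernel_denom_neq0.
exact: (arc_integralB phi0 h1 h2 dkernel_bounded).
Qed.

Lemma kernel_arc_integrable (v : R) : 0 < v ->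
  mu.-integrable `[0, phi] (EFin \o (fun th => Re (K (log_polar v th)))).
Proof.
move=> v0; apply: integrable_itvcc => th thphi.
have h1 := curve_holo_kernel c t gam kernel_denom_neq0.
by have /is_cderive_Re/is_derive_continuous := h1 (log_polar v) th 'i thphi (is_cderive_log_polar_angle v th).
Qed.

Lemma arc_integral_kernel_le (v : R) : 0 < v ->
  `|arc_integral K phi v| <=
  phi * (normc c * (expR (t * v) * v `^ gam) / (m * (v `^ al + lam))).
Proof.
move=> v0.
apply: (le_trans (le_normr_Rintegral _ _)); [exact: measurable_itv|exact: kernel_arc_integrable|].
set B := (X in phi * X).
apply: (@le_trans _ _ (\int[mu]_(th in `[0, phi]) B)).
  apply: le_Rintegral; [exact: measurable_itv|..].
  - exact: (integrable_norm (kernel_arc_integrable v0)).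
  - by apply: integrable_itvcc => th _; exact: cst_continuous.
  - move=> th; rewrite /= in_itv /= => thphi.
    exact: le_trans (Re_le_normc _) (normc_kernel_le v0 thphi).
rewrite Rintegral_cst; last exact: measurable_itv.
rewrite /= lebesgue_measure_itv /= lte_fin.
have [h|h] := ltP 0 phi; first by rewrite -EFinB /= subr0 mulrC.
by rewrite (_ : phi = 0) /= ?mulr0 ?mul0r//; apply/eqP; rewrite eq_le h.
Qed.

End sector.
End kernel_bounds.

(** * The Gamma function *)

Section gamma.
Context {R : realType}.
Notation mu := (@lebesgue_measure R).

Lemma powR_posD (v x y : R) : 0 < v -> v `^ (x + y) = v `^ x * v `^ y.
Proof. by move=> v0; rewrite !powR_exp// mulrDl expRD. Qed.

Lemma powR_pred (v x : R) : 0 < v -> v `^ x = v `^ (x - 1) * v.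
Proof.
by move=> v0; have := powR_posD (x - 1) 1 v0; rewrite subrK powRr1 ?ltW.
Qed.

(** The inequality ln y <= y at y = u / p, multiplied by p and exponentiated. *)
Lemma powR_le_expR (p u : R) : 0 < p -> 0 < u -> u `^ p <= p `^ p * expR u.
Proof.
move=> p0 u0; rewrite !powR_exp// -expRD ler_expR.
have up0 : 0 < u / p by rewrite divr_gt0.
have := ln_sublinear up0; rewrite ln_div ?posrE// => h.
have : p * (ln u - ln p) <= p * (u / p) by rewrite ler_wpM2l// ltW.
rewrite [p * (u / p)]mulrC divfK ?gt_eqF//; lra.
Qed.

(** Bounds the powers of u for all exponents in an interval by one function of
    u, integrable whenever both end exponents are. *)
Lemma powR_interp (u a b y : R) : 0 < u -> a <= y <= b ->
  u `^ y <= u `^ a + u `^ b.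
Proof.
move=> u0 /andP[ay yb].
have [u1|u1] := leP u 1.
  apply: (@le_trans _ _ (u `^ a)); last by rewrite lerDl powR_ge0.
  by apply: ger_powR => //; rewrite u0.
apply: (@le_trans _ _ (u `^ b)); last by rewrite lerDr powR_ge0.
by apply: ler_powR => //; exact: ltW.
Qed.

Lemma powR_continuous (x u : R) : 0 < u -> {for u, continuous (fun v : R => v `^ x)}.
Proof.
by move=> u0; apply: is_derive_continuous; exact: is_derive1_powR.
Qed.

Lemma expRN_is_derive (t u : R) :
  is_derive u 1 (fun v : R => expR (- (t * v))) (- t * expR (- (t * u))).
Proof.
have h : is_derive u 1 (fun v : R => - (t * v)) (- t).
  rewrite (_ : (fun v : R => _) = (- t) *: id); last first.
    by apply/funext => v; rewrite -mulNr.
  by apply: is_derive_eq; rewrite /GRing.scale /= mulr1.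
have := @is_derive1_comp _ expR (fun v : R => - (t * v)) _ _ _ (is_derive_expR (- (t * u))) h.
by rewrite mulrC.
Qed.

Lemma expRN_continuous (t u : R) : {for u, continuous (fun v : R => expR (- (t * v)))}.
Proof. exact: is_derive_continuous (expRN_is_derive t u). Qed.

(** A comparison function with power decay v^(e-1) at 0 and v^(-e-1) at infinity
    whose integrability is immediate: it is a multiple of the derivative of the
    bounded function 1 / (1 + v^e). *)
Lemma invS_powR_integrable (e : R) : 0 < e ->
  mu.-integrable `]0, +oo[ (EFin \o (fun v : R => v `^ (e - 1) / (1 + v `^ e) ^+ 2)).
Proof.
move=> e0.
have D0 v : 1 + v `^ e != 0 :> R.
  by rewrite gt_eqF// ltr_pwDl// powR_ge0.
pose f (v : R) := v `^ (e - 1) / (1 + v `^ e) ^+ 2.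
pose F (v : R) := - e^-1 * (1 + v `^ e)^-1.
have cont (v : R) : 0 < v -> {for v, continuous f}.
  move=> v0; apply: continuousM; first exact: powR_continuous.
  apply: continuousV; first by rewrite expf_neq0.
  have h : {for v, continuous (fun v : R => 1 + v `^ e)}.
    by apply: continuousD; [exact: cst_continuous|exact: powR_continuous].
  exact: (continuousM h h).
have dF (v : R) : 0 < v -> is_derive v 1 F (f v).
  move=> v0.
  have h := is_deriveD (is_derive_cst (1 : R) v 1) (is_derive1_powR e v0).
  have h2 := @is_deriveV _ (fun v : R => 1 + v `^ e) v _ 1 (D0 v) h.
  have h3 := is_deriveZ (- e^-1) h2.
  have -> : f v = - e^-1 *: (- (1 + v `^ e) ^- 2 *: (0 + e * v `^ (e - 1))).
    by rewrite /f /GRing.scale /=; field; rewrite D0 gt_eqF.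
  exact: h3.
have f0 (v : R) : 0 < v -> 0 <= f v.
  by move=> v0; rewrite divr_ge0 ?powR_ge0// exprn_ge0// ltW// ltr_pwDl// powR_ge0.
have FM (v : R) : 0 < v -> - e^-1 <= F v <= 0.
  move=> v0; have i1 : 0 < (1 + v `^ e)^-1 <= 1.
    by rewrite invr_gt0 ltr_pwDl ?powR_ge0//= invf_le1 ?lerDl ?powR_ge0// ltr_pwDl ?powR_ge0.
  have ei : 0 < e^-1 by rewrite invr_gt0.
  case/andP: i1; rewrite /F; move: (_^-1) ei => x x0 y0 y1; nra.
exact: (integrable_pos_primitive dF cont f0 FM).
Qed.

(** The integrand of Gamma is the case t = 1.  The parameter t stays because the
    densities of the Laplace transform at t are compared with this one. *)
Definition gamma_density (t x v : R) : R := expR (- (t * v)) * v `^ (x - 1).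

Lemma gamma_density_continuous (t x v : R) : 0 < v ->
  {for v, continuous (gamma_density t x)}.
Proof.
move=> v0; apply: continuousM; first exact: expRN_continuous.
exact: powR_continuous.
Qed.

Lemma gamma_density_ge0 (t x v : R) : 0 <= gamma_density t x v.
Proof. by rewrite mulr_ge0 ?expR_ge0 ?powR_ge0. Qed.

Lemma gamma_density_integrable (t x : R) : 0 < t -> 0 < x ->
  mu.-integrable `]0, +oo[ (EFin \o gamma_density t x).
Proof.
move=> t0 x0.
(* By powR_le_expR, e^(-tv) v^(2x) is bounded; together with e^(-tv) <= 1
   and (1 + v^x)^2 <= 2 (1 + v^(2x)) this bounds e^(-tv) (1 + v^x)^2 by C. *)
pose C := 2 * (1 + ((2 * x) `^ (2 * x)) * t `^ (- (2 * x))).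
apply: (@integrable_pos_le _ _ (fun v => C * (v `^ (x - 1) / (1 + v `^ x) ^+ 2))).
- by move=> v; exact: gamma_density_continuous.
- move=> v v0; rewrite ger0_norm ?gamma_density_ge0// /gamma_density.
  have D0 : 0 < 1 + v `^ x by rewrite ltr_pwDl ?powR_ge0.
  have -> : C * (v `^ (x - 1) / (1 + v `^ x) ^+ 2) = C / (1 + v `^ x) ^+ 2 * v `^ (x - 1).
    by ring.
  rewrite ler_wpM2r ?powR_ge0// ler_pdivlMr ?exprn_gt0//.
  have x20 : 0 < 2 * x by rewrite mulr_gt0.
  have tv0 : 0 < t * v by rewrite mulr_gt0.
  have := powR_le_expR x20 tv0; rewrite (powRM _ (ltW t0) (ltW v0)) => h.
  have h2 : v `^ (2 * x) * expR (- (t * v)) <= (2 * x) `^ (2 * x) * t `^ (- (2 * x)).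
    rewrite powRN ler_pdivlMr ?powR_gt0// mulrAC expRN ler_pdivrMr ?expR_gt0//.
    by rewrite mulrC.
  have e1 : expR (- (t * v)) <= 1 by rewrite expR_le1 oppr_le0 ltW.
  have v2 : v `^ (2 * x) = v `^ x * v `^ x.
    by rewrite mulr_natl mulr2n powR_posD.
  have E0 := expR_gt0 (- (t * v)).
  have s0 := sqr_ge0 (1 - v `^ x).
  rewrite /C; rewrite v2 in h2; nra.
- by apply: integrable_itvZ; exact: invS_powR_integrable.
Qed.

Lemma GammaE (x : R) : Gamma x = \int[mu]_(v in `]0, +oo[) gamma_density 1 x v.
Proof.
by apply: eq_Rintegral => v _; rewrite /gamma_density mul1r mulrC.
Qed.

(** The substitution v -> t v in the Gamma integral. *)
Lemma Rintegral_gamma_density (t x : R) : 0 < t -> 0 < x ->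
  \int[mu]_(v in `]0, +oo[) gamma_density t x v = Gamma x * t `^ (- x).
Proof.
move=> t0 x0.
have e (v : R) : 0 < v -> gamma_density 1 x (t * v) * t = t `^ x * gamma_density t x v.
  move=> v0; rewrite /gamma_density mul1r (powRM _ (ltW t0) (ltW v0)).
  rewrite (powR_pred x t0).
  by ring.
have st (v : R) : is_derive v 1 ( *%R t) t.
  rewrite (_ : *%R t = t *: id); last by apply/funext.
  by apply: is_derive_eq; rewrite /GRing.scale /= mulr1.
have intt : mu.-integrable `]0, +oo[
    (EFin \o (fun v : R => gamma_density 1 x (t * v) * t)).
  apply: (@integrable_pos_le _ _ (fun v => t `^ x * gamma_density t x v)).
  - move=> v v0; apply: continuousM; last exact: cst_continuous.
    apply: continuous_comp; first exact: is_derive_continuous (st v).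
    by apply: gamma_density_continuous; rewrite mulr_gt0.
  - by move=> v v0; rewrite e// ger0_norm// mulr_ge0 ?powR_ge0 ?gamma_density_ge0.
  - by apply: integrable_itvZ; exact: gamma_density_integrable.
have -> : Gamma x = t `^ x * \int[mu]_(v in `]0, +oo[) gamma_density t x v.
  rewrite GammaE (@Rintegral_pos_subst _ _ ( *%R t) (fun=> t))//.
  - rewrite -RintegralZl//; last exact: gamma_density_integrable.
    by apply: eq_Rintegral => v; rewrite inE /= in_itv /= andbT => /e.
  - by move=> v _; exact: cst_continuous.
  - by move=> v v0; rewrite mulr_gt0.
  - by move=> v w _ vw; rewrite ltr_pM2l.
  - have : ( *%R t) v @[v --> (0:R)^'+] --> t * 0.
      by apply: cvg_at_right_filter; exact: is_derive_continuous (st 0).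
    by rewrite mulr0.
  - rewrite (_ : *%R t = fun v => v * t); last by apply/funext => v; rewrite mulrC.
    by apply: gt0_cvgMly.
  - by move=> v; exact: gamma_density_continuous.
  - exact: gamma_density_integrable.
by rewrite mulrAC -powR_posD// subrr powRr0 mul1r.
Qed.

Lemma Gamma_gt0 (x : R) : 0 < x -> 0 < Gamma x.
Proof.
move=> x0; rewrite GammaE.
(* A lower bound of the integrand on [1, 2]. *)
pose c := expR (- 2 - 2 * `|x - 1|).
have intf := gamma_density_integrable ltr01 x0.
have S12 : (`[1, 2]%classic : set R) `<=` `]0, +oo[%classic.
  by move=> u /=; rewrite !in_itv /= andbT => /andP[/(lt_le_trans ltr01)].
have int12 : mu.-integrable `[1, 2] (EFin \o gamma_density 1 x).
  by apply: integrableS intf => //; exact: S12.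
have h1 : c <= \int[mu]_(v in `[1, 2]) gamma_density 1 x v.
  have -> : c = \int[mu]_(v in `[1, 2]) c.
    rewrite Rintegral_cst; last exact: measurable_itv.
    rewrite /= lebesgue_measure_itv /= lte_fin ltr1n /= (_ : 2 - 1 = 1) ?mulr1//.
    by rewrite (natrD _ 1 1) addrK.
  apply: le_Rintegral => //.
    by apply: integrable_itvcc => v _; exact: cst_continuous.
  move=> v; rewrite /= in_itv /= => /andP[v1 v2].
  have v0 := lt_le_trans ltr01 v1.
  rewrite /gamma_density powR_exp// -expRD ler_expR mul1r.
  have l0 : 0 <= ln v by rewrite ln_ge0.
  have lv := ln_sublinear v0.
  have h : - (x - 1) * ln v <= `|x - 1| * 2.
    apply: le_trans (ler_norm _) _; rewrite normrM normrN ler_wpM2l//.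
    by rewrite ger0_norm//; lra.
  move: h; move: (`|_|) => y h; lra.
apply: (@lt_le_trans _ _ c); first exact: expR_gt0.
apply: le_trans h1 _.
rewrite /Rintegral fine_le//.
- by apply: integrable_fin_num => //.
- by apply: integrable_fin_num => //.
- apply: ge0_subset_integral => //; first by case/integrableP: intf.
  by move=> v _; rewrite lee_fin gamma_density_ge0.
Qed.

Lemma cvg_gamma_density_y (t x : R) : 0 < t -> 0 < x ->
  expR (- (t * u)) * u `^ x @[u --> +oo] --> (0:R).
Proof.
move=> t0 x0.
have x10 : 0 < x + 1 by rewrite ltr_wpDl// ltW.
pose M := (x + 1) `^ (x + 1) * t `^ (- (x + 1)).
apply: (@squeeze_cvgr _ _ _ _ (cst 0) (fun u => M * u^-1)).
- near=> u.
  have u0 : 0 < u by near: u; exact: nbhs_pinfty_gt.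
  rewrite mulr_ge0 ?expR_ge0 ?powR_ge0//=.
  have tu0 : 0 < t * u by rewrite mulr_gt0.
  have := powR_le_expR x10 tu0; rewrite (powRM _ (ltW t0) (ltW u0)) => h.
  rewrite ler_pdivlMr// -mulrA -[X in _ * X](_ : u `^ (x + 1) = _); last first.
    by rewrite powR_posD// powRr1// ltW.
  by rewrite /M powRN ler_pdivlMr ?powR_gt0// expRN -mulrA mulrC ler_pdivrMr ?expR_gt0// mulrC.
- exact: cvg_cst.
- rewrite -(mulr0 M); apply: cvgM; first exact: cvg_cst.
  apply/(@gtr0_cvgV0 _ _ _ _ (fun u : R => u)).
    exact: nbhs_pinfty_gt.
  exact: cvg_id.
Unshelve. all: by end_near. Qed.

Lemma Gamma1 : Gamma 1 = 1 :> R.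
Proof.
rewrite GammaE.
have dF (v : R) : 0 < v ->
    is_derive v 1 (fun v => - expR (- (1 * v))) (gamma_density 1 1 v).
  move=> v0; have h := is_deriveN (expRN_is_derive 1 v).
  have -> : gamma_density 1 1 v = - (- 1 * expR (- (1 * v))).
    by rewrite /gamma_density subrr powRr0 mulr1 mulN1r opprK.
  exact: h.
transitivity (0 - (-1) : R); last by rewrite sub0r opprK.
apply: (Rintegral_FTC2_pos dF).
- by move=> v; exact: gamma_density_continuous.
- exact: gamma_density_integrable.
- apply: cvg_at_right_filter; apply: cvgN.
  by have := @expRN_continuous 1 0; rewrite /prop_for /continuous_at mulr0 oppr0 expR0.
- rewrite -oppr0; apply: cvgN; under eq_fun do rewrite mul1r.
  exact: cvgr_expR.
Qed.

Lemma GammaS (x : R) : 0 < x -> Gamma (x + 1) = x * Gamma x.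
Proof.
move=> x0; have x10 : 0 < x + 1 by rewrite ltr_wpDl// ltW.
apply/eqP; rewrite -subr_eq0; apply/eqP.
have intZ : mu.-integrable `]0, +oo[ (EFin \o (fun v => x * gamma_density 1 x v)).
  by apply: integrable_itvZ; exact: gamma_density_integrable.
have intS := gamma_density_integrable ltr01 x10.
rewrite !GammaE -RintegralZl//; last exact: gamma_density_integrable.
rewrite -RintegralB//.
have dF (v : R) : 0 < v -> is_derive v 1 (fun v => - (expR (- (1 * v)) * v `^ x))
    (gamma_density 1 (x + 1) v - x * gamma_density 1 x v).
  move=> v0.
  have h := is_deriveN (is_deriveM (expRN_is_derive 1 v) (is_derive1_powR x v0)).
  have -> : gamma_density 1 (x + 1) v - x * gamma_density 1 x v =
    - (expR (- (1 * v)) *: (x * v `^ (x - 1)) + v `^ x *: (- 1 * expR (- (1 * v)))).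
    by rewrite /gamma_density addrK /GRing.scale /=; ring.
  exact: h.
transitivity (0 - 0 : R); last exact: subr0.
apply: (Rintegral_FTC2_pos dF).
- move=> v v0; apply: continuousB; first exact: gamma_density_continuous.
  by apply: continuousM; [exact: cst_continuous|exact: gamma_density_continuous].
- exact: integrable_itvB.
- have e0 : expR (- (1 * v)) @[v --> (0:R)^'+] --> expR (- (1 * (0:R))).
    by apply: cvg_at_right_filter; exact: expRN_continuous.
  have h := cvgN (cvgM e0 (powR_cvg0 x0)).
  rewrite [X in _ --> X](_ : _ = 0) in h; last by rewrite mulr0 oppr0.
  exact: h.
- by rewrite -oppr0; apply: cvgN; exact: cvg_gamma_density_y.
Qed.

Lemma Gamma_continuous (x : R) : 0 < x -> {for x, continuous (@Gamma R)}.
Proof.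
move=> x0.
have x20 : 0 < x / 2 by rewrite divr_gt0.
have x2 : 0 < 2 * x by rewrite mulr_gt0.
pose I := `](x / 2), (2 * x)[%classic : set R.
(* Dominates all the integrands with exponent parameter between x / 2 and
   2 x. *)
pose g (v : R) := gamma_density 1 (x / 2) v + gamma_density 1 (2 * x) v.
have xI : I x by rewrite /I /= in_itv /=; apply/andP; split; lra.
have mB : measurable (`]0, +oo[%classic : set (measurableTypeR R)).
  exact: measurable_itv.
rewrite (_ : @Gamma R = fun y => \int[mu]_(v in `]0, +oo[) gamma_density 1 y v); last first.
  by apply/funext => y; exact: GammaE.
apply: (@continuity_under_integral R _ _ mu (gamma_density 1) _ mB (x / 2) (2 * x) _ _ g).
- move=> y; rewrite /= in_itv /= => /andP[/(lt_trans x20) y0 _].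
  exact: gamma_density_integrable.
- apply: aeW => v; rewrite /= in_itv /= andbT => v0 y _.
  suff h : {for y, continuous (fun y : R => expR (- (1 * v)) * v `^ (y - 1))} by exact: h.
  apply: continuousM; first exact: cst_continuous.
  rewrite (_ : (fun y : R => v `^ (y - 1)) = fun y => expR ((y - 1) * ln v)); last first.
    by apply/funext => z; rewrite powR_exp.
  apply: continuous_comp; last exact: continuous_expR.
  apply: continuousM; last exact: cst_continuous.
  by apply: continuousB; [exact: cvg_id|exact: cst_continuous].
- by apply: integrable_itvD; exact: gamma_density_integrable.
- move=> y; rewrite /= in_itv /= => /andP[y1 y2].
  apply: aeW => v; rewrite /= in_itv /= andbT => v0.
  rewrite ger0_norm ?gamma_density_ge0// /g /gamma_density -mulrDr ler_wpM2l ?expR_ge0//.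
  by apply: powR_interp => //; rewrite !lerD2r !ltW.
- by rewrite inE.
Qed.

End gamma.

#[local] Opaque Gamma pi.

(** * The beta integral and its duplication *)

Section duplication.
Import ComplexField.Normc.
Local Open Scope complex_scope.
Context {R : realType}.
Local Notation Re := (@complex.Re R).
Local Notation Im := (@complex.Im R).
Notation mu := (@lebesgue_measure R).

Definition beta_density (z v : R) : R := v `^ (z - 1) / (1 + v).

Lemma beta_density_continuous (z v : R) : 0 < v ->
  {for v, continuous (beta_density z)}.
Proof.
move=> v0; apply: continuousM; first exact: powR_continuous.
apply: continuousV; first by rewrite gt_eqF// addr_gt0.
by apply: continuousD; [exact: cst_continuous|exact: cvg_id].
Qed.

Lemma beta_density_ge0 (z v : R) : 0 < v -> 0 <= beta_density z v.
Proof. by move=> v0; rewrite divr_ge0 ?powR_ge0// addr_ge0// ltW. Qed.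

Lemma beta_density_integrable (z : R) : 0 < z < 1 ->
  mu.-integrable `]0, +oo[ (EFin \o beta_density z).
Proof.
move=> /andP[z0 z1].
(* With e <= z and e <= 1 - z, the exponents z - e and z + e of v that occur
   when the denominators are cleared lie between 0 and 1. *)
pose e := Num.min z (1 - z).
have e0 : 0 < e by rewrite lt_min z0 subr_gt0.
have ez : e <= z by rewrite ge_min lexx.
have ez1 : e <= 1 - z by rewrite ge_min lexx orbT.
apply: (@integrable_pos_le _ _ (fun v => 4 * (v `^ (e - 1) / (1 + v `^ e) ^+ 2))).
- by move=> v; exact: beta_density_continuous.
- move=> v v0; rewrite ger0_norm ?beta_density_ge0// /beta_density.
  have -> : v `^ (z - 1) = v `^ (e - 1) * v `^ (z - e).
    by rewrite -powR_posD//; congr powR; ring.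
  have D0 : 0 < 1 + v `^ e by rewrite ltr_pwDl ?powR_ge0.
  have D1 : 0 < 1 + v by rewrite addr_gt0.
  rewrite mulrCA -mulrA ler_wpM2l ?powR_ge0// ler_pdivrMr//.
  rewrite mulrAC ler_pdivlMr ?exprn_gt0//.
  have h1 : v `^ (z - e) <= 1 + v.
    have -> : 1 + v = v `^ 0 + v `^ 1 by rewrite powRr0 powRr1// ltW.
    by apply: powR_interp => //; apply/andP; split; lra.
  have h2 : v `^ (z - e) * v `^ e * v `^ e <= 1 + v.
    have -> : 1 + v = v `^ 0 + v `^ 1 by rewrite powRr0 powRr1// ltW.
    by rewrite -!powR_posD//; apply: powR_interp => //; apply/andP; split; lra.
  have h3 : 0 <= v `^ (z - e) * (1 - v `^ e) ^+ 2 by rewrite mulr_ge0 ?powR_ge0 ?sqr_ge0.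
  move: h1 h2 h3; move: (v `^ (z - e)) (v `^ e) => x y h1 h2 h3.
  rewrite (_ : x * (1 + y) ^+ 2 = 2 * x + 2 * (x * y * y) - x * (1 - y) ^+ 2); last by ring.
  lra.
- by apply: integrable_itvZ; exact: invS_powR_integrable.
Qed.

Definition beta_integral (z : R) := \int[mu]_(v in `]0, +oo[) beta_density z v.

Section duplication.
Variable z : R.
Hypothesis z01 : 0 < z < 1.
Let c := cexp (0 +i* (- (z * (pi / 2)))).
Let K := kernel c 0 1 1 z.

Let Im_pihalf (v : R) : 0 < v ->
  Im (K (log_polar v (pi / 2))) = - (v `^ z * v / (1 + v ^+ 2)).
Proof.
move=> v0; rewrite /K /kernel mul0r add0r mul1r cexp_log_polar// cos_pihalf sin_pihalf.
rewrite /c -cexpD (_ : _ + _ = (z * ln v)%:C); last first.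
  by apply/eqP; rewrite eq_complex ReD ImD Re_scale Im_scale /= add0r addNr !eqxx.
rewrite mulr0 mulr1 ImM ImV /cexp /= cos0 sin0 mulr0 mulr1 mul0r addr0 -powR_exp//.
by rewrite add0r addr0 expr1n mulrN mulrA.
Qed.

Let Im_0 (v : R) : 0 < v ->
  Im (K (log_polar v 0)) = - (sin (z * (pi / 2)) * (v `^ z / (1 + v))).
Proof.
move=> v0; rewrite /K /kernel mul0r add0r mul1r cexp_log_polar// cos0 sin0.
rewrite /c -cexpD (_ : _ + _ = (z * ln v) +i* (- (z * (pi / 2)))); last first.
  by apply/eqP; rewrite eq_complex ReD ImD Re_scale Im_scale /= add0r mulr0 addr0 !eqxx.
rewrite mulr0 mulr1 ImM ImV ReV /cexp /= addr0 cosN sinN -powR_exp//.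
have v1 : 1 + v != 0 by rewrite gt_eqF// addr_gt0.
have v2 : v + 1 != 0 by rewrite addrC.
by field; rewrite ?v1 ?v2.
Qed.

Let den (v : R) := v `^ z / (1 + v ^+ 2).

Let den_cont (v : R) : 0 < v -> {for v, continuous den}.
Proof.
move=> v0; apply: continuousM; first exact: powR_continuous.
have D0 : 1 + v ^+ 2 != 0 by rewrite gt_eqF// ltr_pwDl// sqr_ge0.
apply: (@continuousV _ _ (fun v : R => 1 + v ^+ 2)) => //.
apply: continuousD; first exact: cst_continuous.
exact: exprn_continuous.
Qed.

Let den_int : mu.-integrable `]0, +oo[ (EFin \o den).
Proof.
apply: (@integrable_pos_le _ _ (fun v => 2 * beta_density z v)).
- exact: den_cont.
- move=> v v0; have D0 : 0 < 1 + v ^+ 2 by rewrite ltr_pwDl// sqr_ge0.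
  rewrite ger0_norm; last by rewrite divr_ge0 ?powR_ge0// ltW.
  rewrite /den /beta_density ler_pdivrMr//.
  rewrite (powR_pred z v0).
  have v1 : 0 < 1 + v by rewrite addr_gt0.
  rewrite (_ : 2 * _ * _ = v `^ (z - 1) * (2 * (1 + v ^+ 2) / (1 + v))); last by ring.
  rewrite ler_wpM2l ?powR_ge0// ler_pdivlMr//; nra.
- by apply: integrable_itvZ; exact: beta_density_integrable.
Qed.

Let m := cos (pi / 2 / 2) : R.

Let arc_le (v : R) : 0 < v ->
  `|arc_integral K (pi / 2) v| <= pi / 2 / m * (v `^ z / (v + 1)).
Proof.
move=> v0; have p0 := pi_gt0 R.
apply: le_trans (@arc_integral_kernel_le _ c (pi / 2) 0 1 1 z _ _ _ _ _ v v0) _ => //; try lra.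
rewrite normc_cexp /= expR0 mul0r expR0 !mul1r powRr1 ?(ltW v0)//.
by rewrite -/m invfM le_eqVlt; apply/orP; left; apply/eqP; ring.
Qed.

(** The arcs at radius n and 1/n contribute O(n^(z-1)) and O(n^(-z)). *)
Let quadrant_contour : sin (z * (pi / 2)) * beta_integral z = \int[mu]_(v in `]0, +oo[) den v.
Proof.
have p0 := pi_gt0 R.
case/andP: (z01) => z0 z1.
pose f v := sin (z * (pi / 2)) * beta_density z v - den v.
have intb := beta_density_integrable z01.
have intsb := integrable_itvZ (sin (z * (pi / 2))) intb.
have intf : mu.-integrable `]0, +oo[ (EFin \o f).
  exact: integrable_itvB.
apply/eqP; rewrite -subr_eq0 -RintegralZl// -RintegralB//; apply/eqP.
pose In n := `[n.+1%:R^-1, n.+1%:R]%classic : set R.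
have h1 : \int[mu]_(x in In n) f x @[n --> \oo] --> \int[mu]_(x in `]0, +oo[) f x.
  exact: cvg_Rintegral_invn_n intf.
apply: cvg_unique h1 _ => //.
pose C := pi / 2 / m.
have m0 : 0 < m by apply: cos_half_gt0; apply/andP; split; lra.
have C0 : 0 <= C by rewrite divr_ge0 ?divr_ge0// ltW.
apply: norm_cvg0.
apply: (@squeeze_cvgr _ _ _ _ (cst 0)
  (fun n => C * ((n.+1%:R^-1 : R) `^ (1 - z)) + C * ((n.+1%:R^-1 : R) `^ z))).
- near=> n; rewrite /= normr_ge0 /=.
  have n0 := @invn_gt0 R n.
  have n10 : 0 < n.+1%:R :> R by [].
  have ab := @invn_le_n R n.
  have -> : \int[mu]_(x in In n) f x =
      arc_integral K (pi / 2) n.+1%:R - arc_integral K (pi / 2) n.+1%:R^-1.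
    rewrite (@arc_integral_kernelB _ c (pi / 2) 0 1 1 z _ _ _ _ _ _ _ n0 ab)//; try lra.
    apply: eq_Rintegral => v vI; have v0 : 0 < v.
      by move: vI; rewrite inE /In /= in_itv /= => /andP[/(lt_le_trans n0)].
    rewrite -/K Im_pihalf// Im_0// /f /beta_density /den.
    rewrite (powR_pred z v0).
    have d1 : 1 + v != 0 by rewrite gt_eqF// addr_gt0.
    have d2 : 1 + v ^+ 2 != 0 by rewrite gt_eqF// ltr_pwDl// sqr_ge0.
    by field; rewrite ?d1 ?d2 gt_eqF.
  apply: le_trans (ler_normB _ _) _; apply: lerD.
    apply: le_trans (arc_le n10) _; rewrite ler_wpM2l//.
    have -> : (n.+1%:R^-1 : R) `^ (1 - z) = n.+1%:R `^ z / n.+1%:R.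
      rewrite -powR_inv1// -powRrM -powR_posD//; congr powR; ring.
    by rewrite ler_wpM2l ?powR_ge0// lef_pV2 ?posrE// ?addr_gt0// lerDl.
  apply: le_trans (arc_le n0) _; rewrite ler_wpM2l//.
  by rewrite ler_pdivrMr ?addr_gt0// ler_peMr ?powR_ge0// lerDr ltW.
- exact: cvg_cst.
- have hp (p : R) : 0 < p -> (n.+1%:R^-1 : R) `^ p @[n --> \oo] --> (0 : R).
    by move=> p0'; apply: (cvg_comp _ _ _ (powR_cvg0 p0')); exact: cvg_invn_at_right0.
  rewrite -[X in _ --> X]addr0 -[X in _ --> X + X](mulr0 C).
  apply: cvgD; (apply: cvgM; first exact: cvg_cst); apply: hp => //.
  by rewrite subr_gt0.
Unshelve. all: by end_near. Qed.

(** Integrate s^z / (1 + s) ds / s along the boundary of the first quadrant.  On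
    the imaginary axis s = i v the numerator has the phase i^z; the constant c
    removes it, so that in dv the imaginary part there is - v^z / (1 + v^2), while on
    the real axis it is - sin (pi z / 2) v^(z-1) / (1 + v).  Finally v^2 is taken as a
    new variable. *)
Lemma beta_integral_duplication :
  2 * sin (z * (pi / 2)) * beta_integral z = beta_integral ((1 + z) / 2).
Proof.
case/andP: (z01) => z0 z1.
(* The integrand of B((1 + z) / 2) after the substitution v -> v^2. *)
have e (v : R) : 0 < v -> beta_density ((1 + z) / 2) (v * v) * (2 * v) = 2 * den v.
  move=> v0; rewrite /beta_density /den.
  have -> : (v * v) `^ ((1 + z) / 2 - 1) = v `^ (z - 1).
    rewrite (powRM _ (ltW v0) (ltW v0)) -powR_posD//; congr powR; by field.
  rewrite (powR_pred z v0).
  by rewrite expr2; ring.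
have dsq (v : R) : 0 < v -> is_derive v 1 (fun v : R => v * v) (2 * v).
  move=> _; have h := is_deriveM (is_derive_id v 1) (is_derive_id v 1).
  have -> : 2 * v = v *: 1 + v *: 1 by rewrite /GRing.scale /=; ring.
  exact: h.
have z2 : 0 < (1 + z) / 2 < 1 by apply/andP; split; lra.
have csq (v : R) : 0 < v -> {for v, continuous (fun v : R => 2 * v)}.
  by move=> _; apply: continuousM; [exact: cst_continuous|exact: cvg_id].
have sq0 (v : R) : 0 < v -> 0 < v * v by move=> v0; exact: mulr_gt0.
have mono (v w : R) : 0 < v -> v < w -> v * v < w * w.
  by move=> v0 vw; nra.
have int2 : mu.-integrable `]0, +oo[
    (EFin \o (fun v : R => beta_density ((1 + z) / 2) (v * v) * (2 * v))).
  apply: (@integrable_pos_le _ _ (fun v => 2 * den v)).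
  - move=> v v0; apply: continuousM; last exact: csq.
    apply: continuous_comp; first exact: is_derive_continuous (dsq v v0).
    exact: beta_density_continuous (sq0 _ v0).
  - move=> v v0; rewrite e// ger0_norm// mulr_ge0// divr_ge0 ?powR_ge0//.
    by rewrite addr_ge0// sqr_ge0.
  - exact: integrable_itvZ.
have l0 : (v * v) @[v --> (0:R)^'+] --> (0 : R).
  have h : (v * v) @[v --> (0:R)^'+] --> (0 * 0 : R).
    by apply: cvg_at_right_filter; apply: cvgM; exact: cvg_id.
  by rewrite mulr0 in h.
have ly : (v * v) @[v --> +oo] --> (+oo : set_system R).
  apply/cvgryPge => r; near=> v.
  have v1 : 1 <= v by near: v; exact: nbhs_pinfty_ge.
  apply: (@le_trans _ _ v); last by rewrite ler_peMr// (le_trans ler01).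
  by near: v; apply: nbhs_pinfty_ge; exact: num_real.
rewrite -mulrA quadrant_contour /beta_integral.
rewrite (Rintegral_pos_subst dsq csq sq0 mono l0 ly _ _ int2); last 2 first.
- by move=> v; exact: beta_density_continuous.
- exact: beta_density_integrable.
rewrite -RintegralZl//.
by apply: eq_Rintegral => v; rewrite inE /= in_itv /= andbT => /e.
Unshelve. all: by end_near. Qed.

End duplication.
End duplication.

#[local] Opaque beta_integral.

(** * Euler's reflection formula *)

Section reflection.
Context {R : realType}.
Notation mu := (@lebesgue_measure R).
Let P : set R := `]0, +oo[%classic.

Let inP (v : R) : (v \in P) = (0 < v).
Proof. by apply/idP/idP; rewrite inE /P /= in_itv /= andbT. Qed.

Let integral_indic_pos (k : R) (f : R -> R) :
  mu.-integrable `]0, +oo[ (EFin \o f) ->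
  (\int[mu]_v (\1_P v * (k * f v))%:E = (k * \int[mu]_(v in `]0, +oo[) f v)%:E)%E.
Proof.
move=> intf; rewrite -RintegralZl//.
rewrite /Rintegral fineK; last first.
  by apply: integrable_fin_num => //; exact: integrable_itvZ.
rewrite [RHS]integral_mkcond; apply: eq_integral => v _.
rewrite patchE indicE -/P.
by case: (v \in P); rewrite ?mul1r// mul0r.
Qed.

(** Inserting Gamma(z) = u^z int e^(-u v) v^(z-1) dv into the integral for
    Gamma(1 - z) gives the double integral of e^(-u) e^(-u v) v^(z-1).  In the
    other order the integral over u is 1 / (1 + v). *)
Lemma Gamma_mul_Gamma (z : R) : 0 < z < 1 ->
  Gamma z * Gamma (1 - z) = beta_integral z.
Proof.
move=> z01; case/andP: (z01) => z0 z1.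
pose h (u v : R) : R := expR (- u) * gamma_density u z v.
pose f (x : R * R) : \bar R := (\1_P x.1 * (\1_P x.2 * h x.1 x.2))%:E.
have mP : measurable_fun setT (\1_P : R -> R).
  by apply: measurable_indic; exact: measurable_itv.
have m1 : measurable_fun setT (fst : R * R -> R) by exact: measurable_fst.
have m2 : measurable_fun setT (snd : R * R -> R) by exact: measurable_snd.
have mf : measurable_fun setT f.
  apply/measurable_EFinP; apply: measurable_funM; first exact: (measurableT_comp mP m1).
  apply: measurable_funM; first exact: (measurableT_comp mP m2).
  apply: measurable_funM.
    apply: (measurableT_comp (@measurable_expR R)).
    exact: (measurable_funN m1).
  apply: measurable_funM.
    apply: (measurableT_comp (@measurable_expR R)).
    exact: (measurable_funN (measurable_funM m1 m2)).
  exact: (measurableT_comp (measurable_powR (z - 1)) m2).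
have f0 x : (0 <= f x)%E.
  rewrite lee_fin !indicE; apply: mulr_ge0; first exact: ler0n.
  apply: mulr_ge0; first exact: ler0n.
  by apply: mulr_ge0; [exact: expR_ge0|exact: gamma_density_ge0].
have F := @fubini_tonelli _ _ _ _ _ mu mu f mf f0.
have A : (\int[mu]_x \int[mu]_y f (x, y) = (Gamma z * Gamma (1 - z))%:E)%E.
  rewrite [Gamma (1 - z)]GammaE -integral_indic_pos; last first.
    by apply: gamma_density_integrable; rewrite ?subr_gt0.
  apply: eq_integral => u _; rewrite /f /=.
  have [u0|u0] := boolP (0 < u); last first.
    rewrite indicE inP (negbTE u0) mul0r.
    by under eq_integral do rewrite mul0r; rewrite integral0.
  rewrite indicE inP u0 mul1r.
  under eq_integral do rewrite mul1r.
  rewrite /h integral_indic_pos; last exact: gamma_density_integrable.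
  rewrite (Rintegral_gamma_density u0 z0); congr EFin.
  rewrite /gamma_density mul1r (_ : 1 - z - 1 = - z); last by ring.
  by ring.
have B : (\int[mu]_y \int[mu]_x f (x, y) = (beta_integral z)%:E)%E.
  rewrite -[X in X%:E]mul1r.
  rewrite -(integral_indic_pos 1 (beta_density_integrable z01)).
  apply: eq_integral => v _; rewrite /f /=.
  have [v0|v0] := boolP (0 < v); last first.
    rewrite [in RHS]indicE inP (negbTE v0) mul0r.
    under eq_integral do rewrite [X in _ * (X * _)]indicE inP (negbTE v0) mul0r mulr0.
    by rewrite integral0.
  rewrite [in RHS]indicE inP v0 !mul1r.
  under eq_integral do rewrite [X in _ * (X * _)]indicE inP v0 mul1r.
  have v1 : 0 < 1 + v by rewrite addr_gt0.
  have e (u : R) : 0 < u -> h u v = v `^ (z - 1) * gamma_density (1 + v) 1 u.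
    move=> u0; rewrite /h /gamma_density subrr powRr0 mulr1 mulrA -expRD mulrC.
    by congr (_ * expR _); ring.
  transitivity (\int[mu]_u (\1_P u * (v `^ (z - 1) * gamma_density (1 + v) 1 u))%:E)%E.
    apply: eq_integral => u _; rewrite indicE inP.
    by have [u0|_] := boolP (0 < u); [rewrite e|rewrite !mul0r].
  rewrite integral_indic_pos; last exact: gamma_density_integrable.
  by rewrite (Rintegral_gamma_density v1 ltr01) Gamma1 mul1r (powR_inv1 (ltW v1)).
apply: EFin_inj; exact: etrans (esym A) (etrans F B).
Qed.

Definition reflection_ratio (z : R) := Gamma z * Gamma (1 - z) * sin (pi * z) / pi.

(** Both sides are beta integrals by Gamma_mul_Gamma.  The duplication contributes
    2 sin (pi z / 2), and sin (pi (1 + z) / 2) = cos (pi z / 2) completes it to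
    sin (pi z). *)
Lemma reflection_ratio_half (z : R) : 0 < z < 1 ->
  reflection_ratio ((1 + z) / 2) = reflection_ratio z.
Proof.
move=> z01; case/andP: (z01) => z0 z1.
have z2 : 0 < (1 + z) / 2 < 1 by apply/andP; split; lra.
rewrite /reflection_ratio (Gamma_mul_Gamma z01) (Gamma_mul_Gamma z2).
rewrite -(beta_integral_duplication z01).
have -> : pi * ((1 + z) / 2) = z * (pi / 2) + pi / 2 by field.
have -> : pi * z = z * (pi / 2) + z * (pi / 2) by field.
have p0 : pi != 0 :> R by rewrite gt_eqF// pi_gt0.
by rewrite sinDpihalf sinD; move: p0; generalize (pi : R) => p p0; field.
Qed.

(** Halving the distance to 1 does not change the ratio.  Near 1, by the
    functional equation, the ratio at 1 - e is
    Gamma(1 - e) Gamma(1 + e) sin (pi e) / (pi e), which tends to Gamma(1)^2 = 1. *)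
Lemma reflection_ratio1 (z : R) : 0 < z < 1 -> reflection_ratio z = 1.
Proof.
move=> z01.
pose e n := (1 - z) / 2 ^+ n.
have e01 n : 0 < e n < 1.
  have p2 : 1 <= 2 ^+ n :> R by rewrite exprn_ege1// ler1n.
  have p20 : 0 < 2 ^+ n :> R by exact: lt_le_trans p2.
  case/andP: z01 => z0 z1; rewrite /e divr_gt0 ?subr_gt0//= ltr_pdivrMr// mul1r.
  by apply: lt_le_trans p2; rewrite ltrBlDr ltrDl.
have zE n : reflection_ratio (1 - e n) = reflection_ratio z.
  elim: n => [|n IH].
    by rewrite /e expr0 divr1; congr reflection_ratio; ring.
  rewrite -IH -[RHS]reflection_ratio_half.
    by congr reflection_ratio; rewrite /e exprS; field; rewrite expf_neq0.
  by case/andP: (e01 n) => ? ?; apply/andP; split; lra.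
have el : e n @[n --> \oo] --> (0 : R).
  have h : `|(2^-1 : R)| < 1 by rewrite ger0_norm// invf_lt1// ltr1n.
  rewrite (_ : e = geometric (1 - z) 2^-1); first exact: cvg_geometric.
  by apply/funext => n; rewrite /geometric /= exprVn.
have sinc : (pi * e n)^-1 * sin (pi * e n) @[n --> \oo] --> (1 : R).
  have A1 n : pi * e n != 0.
    by rewrite mulf_neq0 ?gt_eqF ?pi_gt0//; case/andP: (e01 n).
  have A2 : pi * e n @[n --> \oo] --> (0 : R).
    by have := cvgM (cvg_cst (pi : R)) el; rewrite mulr0; apply.
  have [+ ds] := is_derive_sin (0 : R).
  move=> /cvg_ex[/= l hl]; have := ds; rewrite /derive (cvg_lim _ hl)//.
  rewrite cos0 => l1; move: hl; rewrite l1 => /cvgr_dnbhsP/(_ _ (conj A1 A2)).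
  apply: cvg_trans; apply: near_eq_cvg; near=> n.
  by rewrite sin0 subr0 addr0 /GRing.scale /= mulr1.
have h1 : reflection_ratio (1 - e n) @[n --> \oo] --> (1 : R).
  have E n : reflection_ratio (1 - e n) =
      Gamma (1 - e n) * Gamma (1 + e n) * ((pi * e n)^-1 * sin (pi * e n)).
    case/andP: (e01 n) => en0 en1.
    rewrite /reflection_ratio (_ : 1 - (1 - e n) = e n); last by ring.
    rewrite [1 + e n]addrC (GammaS en0).
    have -> : pi * (1 - e n) = - (pi * e n) + pi by ring.
    have p0 : pi != 0 :> R by rewrite gt_eqF// pi_gt0.
    have e0 : e n != 0 by rewrite gt_eqF.
    rewrite sinDpi sinN opprK; move: p0; generalize (pi : R) => p p0.
    by field; rewrite p0 e0.
  under eq_fun do rewrite E.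
  have G1 (s : R ^nat) : s @ \oo --> (0:R) -> Gamma (1 + s n) @[n --> \oo] --> (1 : R).
    move=> s0; have := Gamma_continuous (@ltr01 R).
    rewrite /prop_for /continuous_at Gamma1.
    apply: cvg_comp.
    by have := cvgD (cvg_cst (1 : R)) s0; rewrite addr0; apply.
  have gN : Gamma (1 - e n) @[n --> \oo] --> (1 : R).
    apply: (G1 (fun n => - e n)).
    by have := cvgN el; rewrite oppr0; apply.
  have := cvgM (cvgM gN (G1 _ el)) sinc.
  by rewrite !mulr1; apply.
have h2 : reflection_ratio (1 - e n) @[n --> \oo] --> reflection_ratio z.
  rewrite (_ : (fun n => _) = cst (reflection_ratio z)); first exact: cvg_cst.
  by apply/funext => n; exact: zE.
by apply/esym; apply: cvg_unique h1 h2.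
Unshelve. all: by end_near. Qed.

End reflection.

(** * The reciprocal Gamma function at 1 - x *)

Section reciprocal.
Context {R : realType}.

Lemma Gamma_reflection (x : R) : 0 < x < 1 ->
  (Gamma (1 - x))^-1 = sin (pi * x) * Gamma x / pi.
Proof.
move=> x01; case/andP: (x01) => x0 x1.
have G1 : Gamma (1 - x) != 0 by rewrite gt_eqF// Gamma_gt0// subr_gt0.
have := reflection_ratio1 x01; rewrite /reflection_ratio => h.
apply: (mulfI G1); rewrite divff// -[LHS]h.
by move: (pi^-1) (sin _) (Gamma x) (Gamma (1 - x)) => p s g g'; ring.
Qed.

Lemma prod_Gamma (m : nat) (x : R) : m%:R < x ->
  (\prod_(i < m) (1 - x + i%:R)) * Gamma (x - m%:R) = (-1) ^+ m * Gamma x.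
Proof.
elim: m => [|m IH] mx; first by rewrite big_ord0 expr0 subr0.
have mx' : m%:R < x by apply: lt_trans mx; rewrite ltr_nat.
have h := IH mx'.
have g := @GammaS _ (x - m.+1%:R); rewrite subr_gt0 in g.
rewrite big_ord_recr /= exprS mulN1r mulNr -h.
have -> : x - m%:R = x - m.+1%:R + 1 by rewrite -natr1; ring.
rewrite (g mx) -natr1.
by move: (Gamma _) (\prod_(_ < _) _) => y z; ring.
Qed.

Lemma sin_addpin (x : R) (m : nat) : sin (x + pi * m%:R) = (-1) ^+ m * sin x.
Proof.
elim: m => [|m IH]; first by rewrite mulr0 addr0 expr0 mul1r.
rewrite -natr1 mulrDr mulr1 addrA sinDpi IH exprS.
by rewrite mulN1r mulNr.
Qed.

(** This turns the coefficient c_k(a) into (-1)^(k+1) sin (pi k a) Gamma(k a) / pi.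
    For x >= 1 the functional equation on one side and the sign changes of the sine
    on the other cancel; the zeros at positive integers x match. *)
Lemma recip_Gamma_reflection (x : R) : 0 < x ->
  recip_Gamma (1 - x) = sin (pi * x) * Gamma x / pi.
Proof.
move=> x0; rewrite /recip_Gamma subr_gt0; case: ltP => x1.
  by apply: Gamma_reflection; rewrite x0.
rewrite opprB; set k := Num.truncn (x - 1).
have /andP[k1 k2] : k%:R <= x - 1 < k.+1%:R by apply: truncn_itv; rewrite subr_ge0.
have km : k.+1%:R < x + 1 by move: k1; rewrite -natr1; lra.
(* For integer x both sides vanish: the last factor of the product and the
   sine.  Otherwise x - k - 1 lies in the open unit interval. *)
move: k1; rewrite le_eqVlt => /predU1P[k1|k1].
  have xk : x = k.+1%:R by rewrite -natr1 k1 subrK.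
  rewrite xk -[pi * _]add0r sin_addpin sin0 mulr0 !mul0r.
  rewrite (bigD1 (@ord_max k))//= -natr1.
  by rewrite (_ : 1 - (k%:R + 1) + k%:R = 0) ?mul0r//; ring.
have mx : k.+1%:R < x by rewrite -natr1; lra.
set y := 1 - x + k.+1%:R.
have y01 : 0 < 1 - y < 1 by rewrite /y; apply/andP; split; lra.
have -> : Gamma y = Gamma (1 - (1 - y)) by congr Gamma; ring.
rewrite (Gamma_reflection y01).
have -> : sin (pi * (1 - y)) = (-1) ^+ k.+1 * sin (pi * x).
  have -> : pi * (1 - y) = pi * x - pi * k.+1%:R by rewrite /y; ring.
  rewrite -[pi * x in RHS](subrK (pi * k.+1%:R)) sin_addpin mulrA -exprD addnn.
  by rewrite -signr_odd odd_double expr0 mul1r.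
have h := prod_Gamma mx.
have -> : 1 - y = x - k.+1%:R by rewrite /y; ring.
rewrite mulrA mulrA [X in X / pi](_ : _ = (-1) ^+ k.+1 * sin (pi * x) *
  ((\prod_(i < k.+1) (1 - x + i%:R)) * Gamma (x - k.+1%:R))); last by ring.
rewrite h; rewrite [X in X / pi](_ : _ = ((-1) ^+ k.+1 * (-1) ^+ k.+1) * (sin (pi * x) * Gamma x)); last by ring.
by rewrite -exprD addnn -signr_odd odd_double expr0 mul1r.
Qed.
End reciprocal.

(** * The Hankel contour *)

Section hankel_contour.
Import ComplexField.Normc.
Local Open Scope complex_scope.
Context {R : realType}.
Local Notation Re := (@complex.Re R).
Local Notation Im := (@complex.Im R).
Notation mu := (@lebesgue_measure R).
Variable t : R.
Hypothesis t0 : 0 < t.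

(** Only the upper side of the negative half-line occurs: on the lower side, the
    integrand is the complex conjugate. *)
Definition ray_density (al lam gam v : R) : R :=
  v^-1 * Im (kernel 1 t al lam gam (log_polar v pi)).

(** The integral of e^(t s) s^gam / (s^al + lam) ds / s along the Hankel contour
    with a circle of radius a, divided by 2 i. *)
Definition hankel (al lam gam a : R) : R :=
  arc_integral (kernel 1 t al lam gam) pi a +
  \int[mu]_(v in `[a, +oo[) ray_density al lam gam v.

Lemma cvg_expRN_powR_y (x : R) :
  expR (- (t * u)) * u `^ x @[u --> +oo] --> (0:R).
Proof.
have x0 : 0 < `|x| + 1 by rewrite ltr_wpDl.
apply: (squeeze_cvgr _ (cvg_cst (0 : R)) (cvg_gamma_density_y t0 x0)).
near=> u.
have u1 : 1 <= u by near: u; apply: nbhs_pinfty_ge; exact: num_real.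
rewrite mulr_ge0 ?expR_ge0 ?powR_ge0//= ler_wpM2l ?expR_ge0//.
apply: ler_powR => //; apply: le_trans (ler_norm _) _; by rewrite lerDl.
Unshelve. all: by end_near. Qed.

(** Away from 0 every exponent is admissible: raising it to a positive one costs
    a constant. *)
Lemma gamma_density_integrable_y (x a : R) : 0 < a ->
  mu.-integrable `[a, +oo[ (EFin \o gamma_density t x).
Proof.
move=> a0; set y := `|x| + 1.
have y0 : 0 < y by rewrite ltr_wpDl.
have xy : x - y <= 0 by rewrite subr_le0 (le_trans (ler_norm _))// lerDl.
have S : (`[a, +oo[%classic : set R) `<=` `]0, +oo[%classic.
  by move=> v /=; rewrite !in_itv /= !andbT; exact: lt_le_trans.
have I1 : mu.-integrable `[a, +oo[ (EFin \o (fun v => a `^ (x - y) * gamma_density t y v)).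
  by apply: integrableS (integrable_itvZ _ (gamma_density_integrable t0 y0)) => //.
apply: le_integrable I1 => //.
  apply/measurable_EFinP; apply: measurable_funS S _ => //.
  by apply: measurable_pos => v; exact: gamma_density_continuous.
move=> v /=; rewrite in_itv /= andbT => av.
have v0 := lt_le_trans a0 av.
rewrite lee_fin !ger0_norm ?gamma_density_ge0//; last first.
  by rewrite mulr_ge0 ?powR_ge0 ?gamma_density_ge0.
rewrite /gamma_density mulrCA ler_wpM2l ?expR_ge0//.
have -> : v `^ (x - 1) = v `^ (x - y) * v `^ (y - 1).
  by rewrite -powR_posD//; congr powR; ring.
rewrite ler_wpM2r ?powR_ge0// !powR_exp// ler_expR.
by rewrite ler_wnM2l// ler_ln ?posrE.
Qed.

Section sector.
Variables al lam gam : R.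
Hypotheses (al01 : 0 <= al < 1) (lam0 : 0 < lam).
Let al0 : 0 <= al. Proof. by case/andP: al01. Qed.
Let alpi : al * pi < pi.
Proof. by case/andP: al01 => _ ?; rewrite -[ltRHS]mul1r ltr_pM2r ?pi_gt0. Qed.
Let m := cos (al * pi / 2).
Let m0 : 0 < m.
Proof. by apply: cos_half_gt0; rewrite alpi mulr_ge0// pi_ge0. Qed.
Let K := kernel 1 t al lam gam.
Let pi0 := pi_ge0 R.
Let pi_in : 0 <= (pi : R) <= pi. Proof. by rewrite pi0 lexx. Qed.

Lemma sector_neq0 (w : R[i]) : strip pi w -> cexp (al%:C * w) + lam%:C != 0.
Proof. exact: (kernel_denom_neq0 al0 alpi lam0). Qed.

Lemma ray_le (v : R) : 0 < v ->
  `|ray_density al lam gam v| <= (m * lam)^-1 * gamma_density t gam v.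
Proof.
move=> v0; rewrite /ray_density normrM ger0_norm ?invr_ge0 ?(ltW v0)//.
have h : `|Im (K (log_polar v pi))| <= expR (- (t * v)) * v `^ gam / (m * lam).
  apply: le_trans (Im_le_normc _) _; rewrite normc_kernel// normc1 mul1r cospi.
  rewrite mulrN1 mulrN ler_wpM2l ?mulr_ge0 ?expR_ge0 ?powR_ge0//.
  have d := kernel_denom_ge al0 alpi lam0 v0 pi_in.
  rewrite lef_pV2 ?posrE ?mulr_gt0//.
    by apply: le_trans d; rewrite ler_wpM2l ?(ltW m0)// lerDr powR_ge0.
  by apply: lt_le_trans d; rewrite mulr_gt0// ltr_pwDr// powR_ge0.
apply: (@le_trans _ _ (v^-1 * (expR (- (t * v)) * v `^ gam / (m * lam)))).
  by rewrite ler_wpM2l// invr_ge0 ltW.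
have -> : gamma_density t gam v = v^-1 * (expR (- (t * v)) * v `^ gam).
  rewrite /gamma_density powR_posD// powR_inv1 ?(ltW v0)//; ring.
by rewrite le_eqVlt; apply/orP; left; apply/eqP; ring.
Qed.

Lemma kernel_radius_continuous (v th : R) : 0 < v -> 0 <= th <= pi ->
  {for v, continuous (fun u => Im (K (log_polar u th)))}.
Proof.
move=> v0 thpi.
have h := curve_holo_kernel 1 t gam sector_neq0.
have h2 := h (fun u => log_polar u th) v _ thpi (is_cderive_log_polar_radius th v0).
exact: is_derive_continuous (is_cderive_Im h2).
Qed.

Lemma ray_continuous (v : R) : 0 < v -> {for v, continuous (ray_density al lam gam)}.
Proof.
move=> v0; apply: continuousM; last exact: kernel_radius_continuous.
by apply: inv_continuous; rewrite gt_eqF.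
Qed.

Lemma ray_integrable_y (a : R) : 0 < a ->
  mu.-integrable `[a, +oo[ (EFin \o ray_density al lam gam).
Proof.
move=> a0.
have I1 := gamma_density_integrable_y gam a0.
have I2 : mu.-integrable `[a, +oo[ (EFin \o (fun v => (m * lam)^-1 * gamma_density t gam v)).
  exact: integrable_itvZ.
apply: le_integrable I2 => //.
  have S : (`[a, +oo[%classic : set R) `<=` `]0, +oo[%classic.
    by move=> v /=; rewrite !in_itv /= !andbT; exact: lt_le_trans.
  apply/measurable_EFinP; apply: measurable_funS S _ => //.
  by apply: measurable_pos => v; exact: ray_continuous.
move=> v /=; rewrite in_itv /= andbT => /(lt_le_trans a0) v0.
by rewrite lee_fin; apply: le_trans (ray_le v0) (ler_norm _).
Qed.

Lemma ray_integrable : 0 < gam ->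
  mu.-integrable `]0, +oo[ (EFin \o ray_density al lam gam).
Proof.
move=> g0; apply: (integrable_pos_le _ ray_le); first exact: ray_continuous.
by apply: integrable_itvZ; exact: gamma_density_integrable.
Qed.

(** On the positive half-line the kernel is real, so this side of the sector does
    not contribute. *)
Lemma Im_kernel_real (v : R) : Im (K (log_polar v 0)) = 0.
Proof.
rewrite /K /kernel mul1r.
have e (z : R) : cexp (z +i* 0) = expR z +i* 0.
  by rewrite /cexp /= cos0 sin0 mulr1 mulr0.
have s (x y : R) : x%:C * (y +i* 0) = (x * y) +i* 0.
  by apply/eqP; rewrite eq_complex Re_scale Im_scale /= mulr0 !eqxx.
have a (x y : R) : (x +i* 0) + (y +i* 0) = (x + y) +i* 0.
  by apply/eqP; rewrite eq_complex ReD ImD /= addr0 !eqxx.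
rewrite /log_polar -[lam%:C]complexr0 !(e, s, a) ImM ImV /=.
by rewrite !mul0r oppr0 mulr0 addr0.
Qed.

(** The change of the arc integral between the radii a and b is, by the integral
    theorem, the part of the ray between them. *)
Lemma hankel_const (a b : R) : 0 < a -> a <= b ->
  hankel al lam gam a = hankel al lam gam b.
Proof.
move=> a0 ab.
have Ia := ray_integrable_y a0.
have Ib := ray_integrable_y (lt_le_trans a0 ab).
have h := @Rintegral_itvB _ (ray_density al lam gam) (BLeft a) +oo%O b Ia.
have {h} : \int[mu]_(v in `[a, +oo[) ray_density al lam gam v =
    \int[mu]_(v in `[a, b]) ray_density al lam gam v + \int[mu]_(v in `[b, +oo[) ray_density al lam gam v.
  rewrite -[X in _ = _ + X]Rintegral_itv_obnd_cbnd; last first.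
    apply: integrableS Ib => //.
    by move=> v /=; rewrite !in_itv /= !andbT; exact: ltW.
  by rewrite -h// addrC subrK.
rewrite /hankel => ->; rewrite addrA; congr (_ + _).
have c := arc_integral_kernelB 1 gam pi0 (ltW t0) al0 alpi lam0 a0 ab.
apply/eqP; rewrite eq_sym -subr_eq0 opprD addrA c subr_eq0; apply/eqP.
by apply: eq_Rintegral => v _; rewrite -/K Im_kernel_real subr0.
Qed.

(** As the radius a tends to 0, the arc contributes O(a^gam). *)
Lemma hankel_shrink (a : R) : 0 < a -> 0 < gam ->
  hankel al lam gam a = \int[mu]_(v in `]0, +oo[) ray_density al lam gam v.
Proof.
move=> a0 g0.
have h1 := cvg_Rintegral_invn_y (ray_integrable g0).
have h2 : arc_integral K pi n.+1%:R^-1 @[n --> \oo] --> (0 : R).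
  pose C := pi * (expR t / (m * lam)).
  apply: norm_cvg0; apply: (@squeeze_cvgr _ _ _ _ (cst 0)
    (fun n => C * ((n.+1%:R^-1 : R) `^ gam))).
  - near=> n; rewrite /= normr_ge0 /=.
    have n0 := @invn_gt0 R n.
    apply: le_trans (arc_integral_kernel_le 1 gam pi0 (ltW t0) al0 alpi lam0 n0) _.
    rewrite /C normc1 mul1r [X in pi * X]mulrAC [leLHS]mulrA ler_wpM2r ?powR_ge0//.
    rewrite ler_wpM2l// -/m; apply: ler_pM; rewrite ?expR_ge0//.
    + rewrite invr_ge0; apply: mulr_ge0; first exact: ltW.
      by rewrite addr_ge0 ?powR_ge0// ltW.
    + rewrite ler_expR ler_piMr ?(ltW t0)//.
      by rewrite invf_le1// ler1n.
    + rewrite lef_pV2 ?posrE ?mulr_gt0//; last by rewrite ltr_pwDr// powR_ge0.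
      by rewrite ler_wpM2l ?(ltW m0)// lerDr powR_ge0.
  - exact: cvg_cst.
  - rewrite -[X in _ --> X](mulr0 C); apply: cvgM; first exact: cvg_cst.
    by apply: (cvg_comp _ _ _ (powR_cvg0 g0)); exact: cvg_invn_at_right0.
have h3 : hankel al lam gam n.+1%:R^-1 @[n --> \oo] -->
    0 + \int[mu]_(v in `]0, +oo[) ray_density al lam gam v by exact: cvgD h2 h1.
rewrite add0r in h3; apply/esym; apply: (cvg_unique _ h3) => //.
apply: cvg_near_cst; near=> n.
have n0 := @invn_gt0 R n.
apply: hankel_const => //.
by near: n; exact: near_invn_le.
Unshelve. all: by end_near. Qed.

End sector.
End hankel_contour.

(** * Hankel's formula for the reciprocal Gamma function *)

Section hankel_formula.
Import ComplexField.Normc.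
Local Open Scope complex_scope.
Context {R : realType}.
Local Notation Re := (@complex.Re R).
Local Notation Im := (@complex.Im R).
Notation mu := (@lebesgue_measure R).

Variable t : R.
Hypothesis t0 : 0 < t.
Let K (gam : R) := kernel 1 t 0 1 gam.
Let H (gam : R) := hankel t 0 1 gam.
Let i01 : 0 <= (0 : R) < 1. Proof. by rewrite lexx ltr01. Qed.
Let l01 := @ltr01 R.
Let pi0 := pi_ge0 R.

Let kernelE (gam : R) (w : R[i]) :
  K gam w = (2^-1)%:C * cexp (t%:C * cexp w + gam%:C * w).
Proof.
rewrite /K /kernel mul0r cexp0 mul1r mulrC; congr (_ * _).
by rewrite fmorphV rmorphD rmorph1.
Qed.

Let dkernelE (gam : R) (w : R[i]) :
  dkernel 1 t 0 1 gam w = t%:C * K (gam + 1) w + gam%:C * K gam w.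
Proof.
rewrite /dkernel -/(K gam) !mul0r subr0 !kernelE rmorphD rmorph1 mulrDl mul1r addrA.
by rewrite [cexp (_ + w)]cexpD; ring.
Qed.

Let Im_pi (gam v : R) : 0 < v ->
  Im (K gam (log_polar v pi)) = 2^-1 * (expR (- (t * v)) * v `^ gam * sin (pi * gam)).
Proof.
move=> v0; rewrite kernelE Im_scale cexp_log_polar// cospi sinpi.
rewrite /cexp ImD ReD !Re_scale !Im_scale /= mulr0 mulr0 add0r mulrN1 mulrN.
by rewrite expRD -powR_exp// [gam * pi]mulrC.
Qed.

Let rayE (gam v : R) : 0 < v ->
  ray_density t 0 1 gam v = sin (pi * gam) / 2 * gamma_density t gam v.
Proof.
move=> v0; rewrite /ray_density -/(K gam) Im_pi// /gamma_density powR_posD// powR_inv1 ?ltW//.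
by ring.
Qed.

(** Shrinking the circle leaves a Gamma integral along the ray, and the
    reflection formula turns it into a reciprocal. *)
Lemma hankel_Gamma_base (x a : R) : 0 < a -> 0 < x < 1 ->
  H x a = pi / 2 * (t `^ (- x) / Gamma (1 - x)).
Proof.
move=> a0 x01; case/andP: (x01) => x0 x1.
rewrite /H hankel_shrink//.
transitivity (sin (pi * x) / 2 * (Gamma x * t `^ (- x))).
  rewrite -Rintegral_gamma_density// -RintegralZl//; last exact: gamma_density_integrable.
  by apply: eq_Rintegral => v; rewrite inE /= in_itv /= andbT => /rayE ->.
rewrite (Gamma_reflection x01).
have p0 : pi != 0 :> R by rewrite gt_eqF// pi_gt0.
move: p0 (sin _) (t `^ _) (Gamma x); generalize (pi : R) => p p0 s T G.
by field.
Qed.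

(** The integral of a derivative over the contour: d (e^(t s) s^gam) is
    e^(t s) (t s^(gam+1) + gam s^gam) ds / s, and e^(t s) s^gam vanishes at the far
    ends. *)
Lemma hankel_rec (gam a : R) : 0 < a -> t * H (gam + 1) a + gam * H gam a = 0.
Proof.
move=> a0.
have h1 := curve_holo_kernel 1 t gam (sector_neq0 i01 l01).
have [ddF h2] := curve_holo_dkernel 1 t gam (sector_neq0 i01 l01).
have arcI g : mu.-integrable `[0, pi] (EFin \o (fun th => Re (K g (log_polar a th)))).
  apply: (kernel_arc_integrable 1 t g (lexx 0) _ ltr01) => //.
  by rewrite mul0r pi_gt0.
have arcZ k g : mu.-integrable `[0, pi] (EFin \o (fun th => k * Re (K g (log_polar a th)))).
  exact: integrable_itvZ.
have A : t * arc_integral (K (gam + 1)) pi a + gam * arc_integral (K gam) pi a =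
    Im (K gam (log_polar a pi)).
  transitivity (\int[mu]_(th in `[0, pi]) Re (dkernel 1 t 0 1 gam (log_polar a th))).
    rewrite -!RintegralZl// -RintegralD//.
    by apply: eq_Rintegral => th _; rewrite dkernelE ReD !Re_scale.
  rewrite (arc_integral_derive pi0 h1 h2 a0) -/(K gam).
  by rewrite [X in _ - X](Im_kernel_real t 0 1 gam a) subr0.
have rI g := ray_integrable_y t0 g i01 l01 a0.
have rZ k g : mu.-integrable `[a, +oo[ (EFin \o (fun v => k * ray_density t 0 1 g v)).
  exact: integrable_itvZ.
pose f v := t * ray_density t 0 1 (gam + 1) v + gam * ray_density t 0 1 gam v.
have fI : mu.-integrable `[a, +oo[ (EFin \o f).
  exact: integrable_itvD.
have dF v : a <= v -> is_derive v 1 (fun v => Im (K gam (log_polar v pi))) (f v).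
  move=> /(lt_le_trans a0) v0.
  have pin : 0 <= (pi : R) <= pi by rewrite lexx pi0.
  have := is_cderive_Im (h1 (fun u => log_polar u pi) v _ pin (is_cderive_log_polar_radius pi v0)).
  have -> : Im ((v^-1)%:C * dkernel 1 t 0 1 gam (log_polar v pi)) = f v; last by [].
  by rewrite dkernelE Im_scale ImD !Im_scale /f /ray_density -/(K gam) -/(K (gam + 1)); ring.
have B : \int[mu]_(v in `[a, +oo[) f v = 0 - Im (K gam (log_polar a pi)).
  apply: (Rintegral_FTC2y dF _ fI).
    move=> v /(lt_le_trans a0) v0.
    by apply: continuousD; (apply: continuousM; first exact: cst_continuous); exact: ray_continuous.
  have h : 2^-1 * (expR (- (t * v)) * v `^ gam) * sin (pi * gam) @[v --> +oo] --> (0 : R).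
    have := cvgM (cvgM (cvg_cst (2^-1 : R)) (cvg_expRN_powR_y t0 gam)) (cvg_cst (sin (pi * gam))).
    by rewrite mulr0 mul0r; apply.
  apply: cvg_trans h; apply: near_eq_cvg; near=> v.
  have v0 : 0 < v by near: v; exact: nbhs_pinfty_gt.
  by rewrite Im_pi //=; ring.
have B2 : \int[mu]_(v in `[a, +oo[) f v = t * \int[mu]_(v in `[a, +oo[) ray_density t 0 1 (gam + 1) v
   + gam * \int[mu]_(v in `[a, +oo[) ray_density t 0 1 gam v.
  by rewrite -!RintegralZl// -RintegralD.
rewrite /H /hankel -/(K gam) -/(K (gam + 1)).
by rewrite !mulrDr addrACA A -B2 B sub0r subrr.
Unshelve. all: by end_near. Qed.

(** For gam = 0 the ray density vanishes because sin (pi gam) does, and on a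
    shrinking arc the integrand tends to 1 / 2. *)
Lemma hankel_Gamma_0 (a : R) : 0 < a -> H 0 a = pi / 2.
Proof.
move=> a0.
pose f (u th : R) := 2^-1 * (expR (t * (u * cos th)) * cos (t * (u * sin th))).
have Hf (u : R) : 0 < u -> H 0 u = \int[mu]_(th in `[0, pi]) f u th.
  move=> u0; rewrite /H /hankel.
  have -> : \int[mu]_(v in `[u, +oo[) ray_density t 0 1 0 v = 0.
    transitivity (\int[mu]_(v in `[u, +oo[) (0 * 0 : R)).
      apply: eq_Rintegral => v; rewrite inE /= in_itv /= andbT => uv.
      by rewrite rayE ?(lt_le_trans u0)// mulr0 sin0 !mul0r.
    by rewrite Rintegral_cst ?mul0r// mulr0 mul0r.
  rewrite addr0; apply: eq_Rintegral => th _.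
  rewrite -/(K 0) kernelE mul0r addr0 Re_scale cexp_log_polar// /cexp Re_scale Im_scale /=.
  by [].
have mB : measurable (`[0, pi]%classic : set (measurableTypeR R)).
  exact: measurable_itv.
have fu (u : R) th : {for u, continuous (fun u : R => f u th)}.
  have h1 x : {for u, continuous (fun u : R => t * (u * x))}.
    apply: continuousM; first exact: cst_continuous.
    by apply: continuousM; [exact: cvg_id|exact: cst_continuous].
  apply: continuousM; first exact: cst_continuous.
  apply: continuousM.
    by apply: (@continuous_comp _ _ _ (fun u : R => t * (u * cos th)) expR);
      [exact: h1|exact: continuous_expR].
  by apply: (@continuous_comp _ _ _ (fun u : R => t * (u * sin th)) cos);
    [exact: h1|exact: continuous_cos].
have fth (u : R) (th : R) : {for th, continuous (fun th : R => f u th)}.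
  have h1 (g : R -> R) : continuous g -> {for th, continuous (fun th : R => t * (u * g th))}.
    move=> cg; apply: continuousM; first exact: cst_continuous.
    by apply: continuousM; [exact: cst_continuous|exact: cg].
  apply: continuousM; first exact: cst_continuous.
  apply: continuousM.
    by apply: (@continuous_comp _ _ _ (fun th : R => t * (u * cos th)) expR);
      [apply: h1; exact: continuous_cos|exact: continuous_expR].
  by apply: (@continuous_comp _ _ _ (fun th : R => t * (u * sin th)) cos);
    [apply: h1; exact: continuous_sin|exact: continuous_cos].
have cF : {for 0, continuous (fun u : R => \int[mu]_(th in `[0, pi]) f u th)}.
  apply: (@continuity_under_integral R _ _ mu f _ mB (-1) 1 _ _ (fun=> expR t)).
  - by move=> u _; apply: integrable_itvcc => th _; exact: fth.
  - by apply: aeW => th _ u _; exact: fu.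
  - by apply: integrable_itvcc => th _; exact: cst_continuous.
  - move=> u; rewrite /= in_itv /= => /andP[u1 u2]; apply: aeW => th _.
    rewrite /f normrM ger0_norm// normrM [`|expR _|]ger0_norm ?expR_ge0//.
    have c1 := cos_max (t * (u * sin th)).
    have e1 : expR (t * (u * cos th)) <= expR t.
      rewrite ler_expR ler_piMr ?(ltW t0)// (le_trans (ler_norm _))// normrM.
      by rewrite mulr_ile1 ?cos_max// ler_norml !ltW.
    have e0 := expR_gt0 (t * (u * cos th)).
    have n0 := normr_ge0 (cos (t * (u * sin th))).
    move: c1 e1 e0 n0; move: (`|_|) (expR (t * _)) => x y c1 e1 e0 n0.
    have : y * x <= y by rewrite ler_piMr// ltW.
    lra.
  - by rewrite inE /= in_itv /= ltrN10 ltr01.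
have f0 : \int[mu]_(th in `[0, pi]) f 0 th = pi / 2.
  transitivity (\int[mu]_(th in `[0, pi]) (2^-1 : R)).
    by apply: eq_Rintegral => th _; rewrite /f !mul0r !mulr0 expR0 cos0 !mulr1.
  rewrite Rintegral_cst; last exact: measurable_itv.
  by rewrite /= lebesgue_measure_itv /= lte_fin pi_gt0 -EFinB /= subr0 mulrC.
have h1 : H 0 n.+1%:R^-1 @[n --> \oo] --> pi / 2.
  rewrite -f0 (_ : (fun n => _) = (fun n : nat => \int[mu]_(th in `[0, pi]) f n.+1%:R^-1 th)).
    apply: (cvg_comp _ _ _ cF) => A /= nA.
    have h := cvg_at_right_filter (@cvg_id _ (nbhs (0:R))).
    exact: (cvg_invn_at_right0 (h _ nA)).
  by apply/funext => n; apply: Hf; exact: invn_gt0.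
apply: (cvg_unique _ _ h1) => //.
apply: cvg_near_cst; near=> n.
apply: (hankel_const t0) => //.
by near: n; exact: near_invn_le.
Unshelve. all: by end_near. Qed.

(** Hankel's formula.  It holds for -1 < be < 0 and for be = 0, and hankel_rec
    raises be by 1, as the functional equation does on the other side.  The factor
    pi / 2 in place of pi comes from the denominator 2 of the kernel. *)
Lemma hankel_Gamma (be a : R) : 0 < a -> -1 < be ->
  H (- be) a = pi / 2 * (t `^ be / Gamma (1 + be)).
Proof.
move=> a0; have [n] : exists n : nat, be <= n%:R.
  by exists (Num.bound `|be|); apply: le_trans (ler_norm _) (ltW (archi_boundP _)).
elim: n be => [|n IH] be ben be1.
  move: ben; rewrite le_eqVlt => /predU1P[->|be0].
    by rewrite oppr0 hankel_Gamma_0// addr0 Gamma1 powRr0 divr1 mulr1.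
  by rewrite hankel_Gamma_base ?opprK//; apply/andP; split; lra.
have [be0|be0] := leP be 0.
  by apply: IH => //; apply: le_trans be0 _.
have h := hankel_rec (- be) a0.
have e : H (- be + 1) a = pi / 2 * (t `^ (be - 1) / Gamma be).
  rewrite (_ : - be + 1 = - (be - 1)); last by ring.
  have q : 1 + (be - 1) = be by ring.
  have b1 : be - 1 <= n%:R by rewrite -natr1 in ben; lra.
  have b2 : -1 < be - 1 by lra.
  by have := IH _ b1 b2; rewrite q.
rewrite e in h.
rewrite [1 + be]addrC (GammaS be0).
rewrite (powR_pred be t0).
have G0 : Gamma be != 0 by rewrite gt_eqF// Gamma_gt0.
have b0 : be != 0 by rewrite gt_eqF.
apply: (mulfI b0).
have -> : be * H (- be) a = t * (pi / 2 * (t `^ (be - 1) / Gamma be)) by lra.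
move: G0; move: (Gamma be) (t `^ _); generalize (pi : R) => p G T G0.
by field; rewrite ?G0 ?b0.
Qed.
End hankel_formula.

(** * The spectral representation of the Mittag-Leffler function *)

Section mittag_leffler.
Import ComplexField.Normc.
Local Open Scope complex_scope.
Context {R : realType}.
Local Notation Re := (@complex.Re R).
Local Notation Im := (@complex.Im R).
Notation mu := (@lebesgue_measure R).
Variables t al lam : R.
Hypotheses (t0 : 0 < t) (al01 : 0 < al < 1) (lam0 : 0 < lam).
Let al01' : 0 <= al < 1. Proof. by case/andP: al01 => /ltW -> ->. Qed.
Let i01 : 0 <= (0 : R) < 1. Proof. by rewrite lexx ltr01. Qed.
Let al0 : 0 <= al. Proof. by case/andP: al01'. Qed.
Let alpi : al * pi < pi.
Proof. by case/andP: al01 => _ ?; rewrite -[ltRHS]mul1r ltr_pM2r ?pi_gt0. Qed.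
Let z0pi : 0 * pi < (pi : R). Proof. by rewrite mul0r pi_gt0. Qed.
Let pi0 := pi_ge0 R.
Let m := cos (al * pi / 2).
Let m0 : 0 < m.
Proof. by apply: cos_half_gt0; rewrite alpi mulr_ge0// pi_ge0. Qed.

(** s^(gam+al) / (s^al + lam) + lam s^gam / (s^al + lam) = s^gam; the factor 2
    undoes the denominator of the kernel with al = 0, lam = 1. *)
Lemma kernel_split (gam : R) (w : R[i]) : strip pi w ->
  kernel 1 t al lam (gam + al) w + lam%:C * kernel 1 t al lam gam w =
  2%:C * kernel 1 t 0 1 gam w.
Proof.
move=> hw; have D := sector_neq0 al01' lam0 hw.
rewrite /kernel mul0r cexp0 rmorphD mulrDl addrA [cexp (_ + al%:C * w)]cexpD.
have -> : 2%:C = 1 + 1 :> R[i] by rewrite rmorphD rmorph1.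
have -> : 1%:C = 1 :> R[i] by rewrite rmorph1.
have D2 : 1 + 1 != 0 :> R[i] by rewrite -[1 + 1]/(2%:R) pnatr_eq0.
by field; rewrite D.
Qed.

Lemma hankel_split (gam a : R) : 0 < a ->
  hankel t al lam (gam + al) a + lam * hankel t al lam gam a =
  2 * hankel t 0 1 gam a.
Proof.
move=> a0.
have arcI g := kernel_arc_integrable 1 t g al0 alpi lam0 a0.
have arcI0 := kernel_arc_integrable 1 t gam (lexx 0) z0pi ltr01 a0.
have rI g := ray_integrable_y t0 g al01' lam0 a0.
have rI0 := ray_integrable_y t0 gam i01 ltr01 a0.
have A : arc_integral (kernel 1 t al lam (gam + al)) pi a +
    lam * arc_integral (kernel 1 t al lam gam) pi a =
    2 * arc_integral (kernel 1 t 0 1 gam) pi a.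
  rewrite /arc_integral -!RintegralZl//.
  rewrite -RintegralD//; last by apply: integrable_itvZ; exact: arcI.
  apply: eq_Rintegral => th thI.
  have thpi : 0 <= th <= pi by move: thI; rewrite inE /= in_itv.
  by rewrite -!Re_scale -ReD kernel_split.
have B : \int[mu]_(v in `[a, +oo[) ray_density t al lam (gam + al) v +
    lam * (\int[mu]_(v in `[a, +oo[) ray_density t al lam gam v) =
    2 * \int[mu]_(v in `[a, +oo[) ray_density t 0 1 gam v.
  rewrite -!RintegralZl// -RintegralD//; last exact: integrable_itvZ.
  apply: eq_Rintegral => v _; rewrite /ray_density mulrCA -mulrDr mulrCA.
  congr (_ * _); rewrite -!Im_scale -ImD kernel_split//.
  by apply/andP; split; [exact: pi0|exact: lexx].
by rewrite /hankel mulrDr addrACA A B -mulrDr.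
Qed.

(** The finite geometric expansion of s^al / (s^al + lam) in powers of
    -lam s^(-al). *)
Lemma hankel_iter (n : nat) (a : R) : 0 < a ->
  hankel t al lam al a =
  \sum_(0 <= j < n) (- lam) ^+ j * (2 * hankel t 0 1 (- (al * j%:R)) a) +
  (- lam) ^+ n * hankel t al lam (al - al * n%:R) a.
Proof.
move=> a0; elim: n => [|n IH].
  by rewrite big_geq// expr0 mul1r add0r mulr0 subr0.
rewrite [LHS]IH [in RHS]big_nat_recr// -addrA; congr (_ + _).
have := hankel_split (- (al * n%:R)) a0.
rewrite (_ : - (al * n%:R) + al = al - al * n%:R); last by ring.
rewrite (_ : al - al * n.+1%:R = - (al * n%:R)); last by rewrite -natr1; ring.
by move=> <-; rewrite exprS; ring.
Qed.

(** On the whole contour |s| >= a, hence |s^(-al n)| <= (a^al)^(-n). *)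
Lemma hankel_bound (a : R) : 0 < a -> exists C : R, forall n : nat,
  `|hankel t al lam (al - al * n%:R) a| <= C * (a `^ al) ^- n.
Proof.
move=> a0.
pose I := \int[mu]_(v in `[a, +oo[) gamma_density t al v.
exists (pi * (expR (t * a) * a `^ al / (m * (a `^ al + lam))) + (m * lam)^-1 * I) => n.
have aE : a `^ (al - al * n%:R) = a `^ al * (a `^ al) ^- n.
  by rewrite powR_posD// powRN powRrM powR_mulrn// powR_ge0.
apply: le_trans (ler_normD _ _) _; rewrite mulrDl; apply: lerD.
  apply: le_trans (arc_integral_kernel_le 1 _ pi0 (ltW t0) al0 alpi lam0 a0) _.
  rewrite normc1 mul1r aE -/m le_eqVlt; apply/orP; left; apply/eqP.
  by set x := _ ^- n; set y := (m * _)^-1; ring.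
have I1 := ray_integrable_y t0 (al - al * n%:R) al01' lam0 a0.
have I2 := gamma_density_integrable_y t0 al a0.
apply: le_trans (le_normr_Rintegral _ I1) _ => //.
have -> : (m * lam)^-1 * I * (a `^ al) ^- n =
    \int[mu]_(v in `[a, +oo[) ((m * lam)^-1 * (a `^ al) ^- n * gamma_density t al v).
  by rewrite RintegralZl//; rewrite /I; set x := _ ^- n; set y := (m * _)^-1; ring.
apply: le_Rintegral => //.
- exact: integrable_norm.
- exact: integrable_itvZ.
- move=> v; rewrite /= in_itv /= andbT => av.
  have v0 := lt_le_trans a0 av.
  apply: le_trans (ray_le t _ al01' lam0 v0) _.
  rewrite -/m -mulrA ler_wpM2l ?invr_ge0 ?mulr_ge0 ?(ltW m0) ?(ltW lam0)//.
  rewrite /gamma_density mulrCA ler_wpM2l ?expR_ge0//.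
  have -> : v `^ (al - al * n%:R - 1) = v `^ (al - 1) * (v `^ al) ^- n.
    by rewrite -powR_mulrn ?powR_ge0// -powRrM -powRN -powR_posD//; congr powR; ring.
  rewrite [leRHS]mulrC ler_wpM2l ?powR_ge0// lef_pV2 ?posrE ?exprn_gt0 ?powR_gt0//.
  rewrite lerXn2r ?nnegrE ?powR_ge0//.
  by apply: ge0_ler_powR; rewrite ?nnegrE ?(ltW a0) ?(ltW v0).
Qed.

(** The partial sums of the Mittag-Leffler series are, by Hankel's formula, those
    of the geometric expansion along the contour; the contour with the full integrand
    is then shrunk to the ray. *)
Lemma mittag_leffler_ray :
  mittag_leffler al (- (lam * t `^ al)) =
  pi^-1 * \int[mu]_(v in `]0, +oo[) ray_density t al lam al v.
Proof.
have [al1 al2] := andP al01.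
(* On this circle |lam s^(-al)| = 1/2, so the error of the geometric
   expansion is O(2^(-n)). *)
pose a := (2 * lam) `^ al^-1.
have l20 : 0 < 2 * lam by rewrite mulr_gt0.
have a0 : 0 < a by rewrite powR_gt0.
have aal : a `^ al = 2 * lam.
  by rewrite /a -powRrM mulVf ?gt_eqF// powRr1// ltW.
have [C HC] := hankel_bound a0.
rewrite -(hankel_shrink t0 al01' lam0 a0 al1).
have p0 : pi != 0 :> R by rewrite gt_eqF// pi_gt0.
apply/cvg_lim => //.
have E n : (series [sequence (- (lam * t `^ al)) ^+ j / Gamma (al * j%:R + 1)]_j) n =
    pi^-1 * (hankel t al lam al a - (- lam) ^+ n * hankel t al lam (al - al * n%:R) a).
  rewrite {1}(hankel_iter n a0) addrK mulr_sumr /series /=.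
  apply: eq_bigr => j _.
  rewrite (hankel_Gamma t0 a0); last first.
    by apply: lt_le_trans (_ : 0 <= _); rewrite ?ltrN10// mulr_ge0.
  rewrite [1 + _]addrC -mulNr exprMn -(powR_mulrn _ (powR_ge0 t al)) -powRrM.
  move: p0 (t `^ _) (Gamma _)^-1 ((- lam) ^+ j).
  by generalize (pi : R) => p p0 x y z; field.
rewrite (_ : series _ = fun n => pi^-1 * (hankel t al lam al a -
    (- lam) ^+ n * hankel t al lam (al - al * n%:R) a)); last first.
  by apply/funext.
have h : (- lam) ^+ n * hankel t al lam (al - al * n%:R) a @[n --> \oo] --> (0 : R).
  apply: norm_cvg0; apply: (@squeeze_cvgr _ _ _ _ (cst 0) (geometric C 2^-1)).
  - near=> n; rewrite /= normr_ge0 /= normrM normrX normrN (gtr0_norm lam0).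
    have -> : C * 2^-1 ^+ n = lam ^+ n * (C * (a `^ al) ^- n).
      rewrite aal exprMn invfM exprVn.
      have l0 : lam ^+ n != 0 by rewrite expf_neq0// gt_eqF.
      by move: (2 ^- n) => x; field.
    by rewrite ler_wpM2l ?exprn_ge0// ltW.
  - exact: cvg_cst.
  - by apply: cvg_geometric; rewrite ger0_norm// invf_lt1// ltr1n.
have := cvgM (cvg_cst (pi^-1 : R)) (cvgB (cvg_cst (hankel t al lam al a)) h).
by rewrite subr0; apply.
Unshelve. all: by end_near. Qed.
End mittag_leffler.

(** * The density of the remainder *)

Section tail.
Import ComplexField.Normc.
Local Open Scope complex_scope.
Context {R : realType}.
Local Notation Re := (@complex.Re R).
Local Notation Im := (@complex.Im R).
Notation mu := (@lebesgue_measure R).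
Variables t lam : R.
Hypotheses (t0 : 0 < t) (lam0 : 0 < lam).
Let pi0 := pi_ge0 R.

Definition spectral_ratio (b v : R) : R[i] := cexp (b%:C * log_polar v pi) / lam%:C.

(** The terms of the geometric expansion of q / (1 + q) from the n-th one on. *)
Definition spectral_tail (n : nat) (b v : R) : R[i] :=
  - (- spectral_ratio b v) ^+ n / (1 + spectral_ratio b v).

Definition tail_density (n : nat) (b v : R) : R :=
  expR (- (t * v)) * v^-1 * Im (spectral_tail n b v).

Let q := spectral_ratio.
Let Q := spectral_tail.
Let m (b : R) := cos (b * pi / 2).

Let lamC0 : lam%:C != 0 :> R[i].
Proof. by rewrite fmorph_eq0 gt_eqF. Qed.

Let m0 (b : R) : 0 < b < 1 -> 0 < m b.
Proof.
move=> /andP[b0 b1]; apply: cos_half_gt0; apply/andP; split.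
  by rewrite mulr_ge0// ltW.
by rewrite -[ltRHS]mul1r ltr_pM2r ?pi_gt0.
Qed.

Lemma normc_spectral_ratio (b v : R) : 0 < v -> normc (q b v) = v `^ b / lam.
Proof.
move=> v0; rewrite /q /spectral_ratio normcM normcV normc_real gtr0_norm//.
by rewrite normc_cexp Re_scale /= powR_exp.
Qed.

Let denE (b v : R) : 1 + q b v = (cexp (b%:C * log_polar v pi) + lam%:C) / lam%:C.
Proof. by rewrite /q /spectral_ratio mulrDl divff// addrC. Qed.

Let pi_in : 0 <= (pi : R) <= pi. Proof. by rewrite pi0 lexx. Qed.

Let den_ge (b v : R) : 0 < b < 1 -> 0 < v ->
  m b * (v `^ b / lam + 1) <= normc (1 + q b v).
Proof.
move=> /andP[b0 b1] v0.
have bpi : b * pi < pi by rewrite -[ltRHS]mul1r ltr_pM2r ?pi_gt0.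
have h := kernel_denom_ge (ltW b0) bpi lam0 v0 pi_in.
rewrite denE normcM normcV normc_real gtr0_norm// ler_pdivlMr//.
apply: le_trans h; rewrite le_eqVlt; apply/orP; left; apply/eqP.
have l0 : lam != 0 by rewrite gt_eqF.
by rewrite -/(m b); move: (m b) => M; field.
Qed.

Let den_gem (b v : R) : 0 < b < 1 -> 0 < v -> m b <= normc (1 + q b v).
Proof.
move=> b01 v0; apply: le_trans (den_ge b01 v0).
by rewrite ler_peMr ?(ltW (m0 b01))// lerDr divr_ge0 ?powR_ge0// ltW.
Qed.

Lemma spectral_den_neq0 (b v : R) : 0 < b < 1 -> 0 < v -> 1 + q b v != 0.
Proof.
move=> b01 v0; have := lt_le_trans (m0 b01) (den_gem b01 v0).
by apply: contraTneq => ->; rewrite normc0 ltxx.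
Qed.

Lemma normc_tail_le (n : nat) (b v : R) : 0 < b < 1 -> 0 < v ->
  normc (Q n b v) <= (m b)^-1 * lam ^- n * v `^ (n%:R * b).
Proof.
move=> b01 v0; rewrite /Q /spectral_tail normcM normcN normcX normcN normcV normc_spectral_ratio//.
rewrite expr_div_n -(powR_mulrn n (powR_ge0 v b)) -powRrM [b * _]mulrC.
rewrite [leRHS]mulrC -mulrA ler_wpM2l ?powR_ge0// [leRHS]mulrC.
rewrite ler_wpM2l ?invr_ge0 ?exprn_ge0 ?(ltW lam0)//.
by rewrite lef_pV2 ?posrE ?m0// ?den_gem// (lt_le_trans (m0 b01)) ?den_gem.
Qed.

(** The factor v^b / lam in the numerator is compensated by the same quantity in
    the lower bound of |1 + q|. *)
Lemma normc_ratio_le (b v : R) : 0 < b < 1 -> 0 < v ->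
  normc (q b v / (1 + q b v)) <= (m b)^-1.
Proof.
move=> b01 v0; rewrite normcM normcV normc_spectral_ratio//.
have d := den_ge b01 v0.
have x0 : 0 <= v `^ b / lam by rewrite divr_ge0 ?powR_ge0// ltW.
have mb := m0 b01.
rewrite ler_pdivrMr; last first.
  by apply: lt_le_trans d; rewrite mulr_gt0// ltr_wpDl.
rewrite [leRHS]mulrC ler_pdivlMr// [leLHS]mulrC; apply: le_trans d.
by rewrite ler_wpM2l ?(ltW mb)// lerDl.
Qed.

(** Stated with the logarithmic derivative d of p.  It is used for p = q as a
    function of the exponent, where d = ln v + i pi, and as a function of v, where
    d = b / v. *)
Lemma is_cderive_geometric_tail (n : nat) (p : R -> R[i]) (x : R) (d : R[i]) :
  1 + p x != 0 -> is_cderive p x (d * p x) ->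
  is_cderive (fun y => - (- p y) ^+ n / (1 + p y)) x
    (d * (- (- p x) ^+ n / (1 + p x)) * (n%:R - p x / (1 + p x))).
Proof.
move=> D0 dp.
have dX k : is_cderive (fun y => (- p y) ^+ k) x (k%:R * d * (- p x) ^+ k).
  elim: k => [|k IH].
    by apply: is_cderive_eq (is_cderive_cst 1 x) _; rewrite !mul0r.
  have dN := is_cderiveM (is_cderive_cst (-1) x) dp.
  have := is_cderiveM dN IH.
  rewrite (_ : (fun y => _) = (fun y => (- p y) ^+ k.+1)); last first.
    by apply/funext => y; rewrite exprS mulN1r.
  move=> h; apply: is_cderive_eq h _.
  by rewrite -[k.+1]addn1 natrD exprD expr1; ring.
have dV := is_cderiveV D0 (is_cderiveD (is_cderive_cst 1 x) dp).
have := is_cderiveM (is_cderiveM (is_cderive_cst (-1) x) (dX n)) dV.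
rewrite (_ : (fun y => _) = (fun y => - (- p y) ^+ n / (1 + p y))); last first.
  by apply/funext => y; rewrite mulN1r.
move=> h; apply: is_cderive_eq h _.
by move: (_ ^+ n) D0 => X D0; field.
Qed.

Lemma is_cderive_spectral_ratio (b v : R) :
  is_cderive (fun b => q b v) b (log_polar v pi * q b v).
Proof.
have h1 : is_cderive (fun b : R => b%:C * log_polar v pi) b (log_polar v pi).
  apply: is_cderive_eq (is_cderiveM (is_cderive_real (is_derive_id b 1)) (is_cderive_cst _ _)) _.
  by rewrite rmorph1 mulr0 addr0 mul1r.
apply: is_cderive_eq (is_cderiveM (is_cderive_exp h1) (is_cderive_cst (lam%:C)^-1 b)) _.
by rewrite /q /spectral_ratio; ring.
Qed.

Lemma is_cderive_spectral_ratio_radius (b v : R) : 0 < v ->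
  is_cderive (q b) v ((b / v)%:C * q b v).
Proof.
move=> v0.
have h1 := is_cderiveM (is_cderive_cst b%:C v) (is_cderive_log_polar_radius pi v0).
apply: is_cderive_eq (is_cderiveM (is_cderive_exp h1) (is_cderive_cst (lam%:C)^-1 v)) _.
by rewrite /q /spectral_ratio rmorphM; ring.
Qed.

Lemma is_cderive_tail (n : nat) (b v : R) : 0 < b < 1 -> 0 < v ->
  is_cderive (fun b => Q n b v) b
    (log_polar v pi * Q n b v * (n%:R - q b v / (1 + q b v))).
Proof.
move=> b01 v0; have D0 := spectral_den_neq0 b01 v0.
exact: (@is_cderive_geometric_tail n (fun b => q b v) b _ D0 (is_cderive_spectral_ratio b v)).
Qed.

(** The partial derivative of the density in the exponent b. *)
Definition tail_density_partial (n : nat) (b v : R) : R :=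
  expR (- (t * v)) * v^-1 *
    Im (log_polar v pi * Q n b v * (n%:R - q b v / (1 + q b v))).

Let expRN_inv_continuous (v : R) : 0 < v ->
  {for v, continuous (fun v : R => expR (- (t * v)) * v^-1)}.
Proof.
move=> v0; apply: continuousM; first exact: expRN_continuous.
by apply: inv_continuous; rewrite gt_eqF.
Qed.

Lemma tail_density_continuous (n : nat) (b v : R) : 0 < b < 1 -> 0 < v ->
  {for v, continuous (tail_density n b)}.
Proof.
move=> b01 v0; apply: continuousM; first exact: expRN_inv_continuous.
have D0 := spectral_den_neq0 b01 v0.
have h := is_cderive_geometric_tail n D0 (is_cderive_spectral_ratio_radius b v0).
exact: is_derive_continuous (is_cderive_Im h).
Qed.

Lemma tail_density_partial_continuous (n : nat) (b v : R) : 0 < b < 1 -> 0 < v ->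
  {for v, continuous (tail_density_partial n b)}.
Proof.
move=> b01 v0; apply: continuousM; first exact: expRN_inv_continuous.
have D0 := spectral_den_neq0 b01 v0.
have dq := is_cderive_spectral_ratio_radius b v0.
have h := is_cderive_geometric_tail n D0 dq.
have dr := is_cderiveM dq (is_cderiveV D0 (is_cderiveD (is_cderive_cst 1 v) dq)).
have dr2 := is_cderiveD (is_cderive_cst n%:R v) (is_cderiveM (is_cderive_cst (-1) v) dr).
have h2 := is_cderiveM (is_cderiveM (is_cderive_log_polar_radius pi v0) h) dr2.
have h3 := is_derive_continuous (is_cderive_Im h2).
suff -> : (fun u => Im (log_polar u pi * Q n b u * (n%:R - q b u / (1 + q b u)))) =
  (fun u => Im (log_polar u pi * Q n b u * (n%:R + -1 * (q b u / (1 + q b u))))).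
  exact: h3.
by apply/funext => u; rewrite mulN1r.
Qed.

Lemma is_derive_tail_density (n : nat) (b v : R) : 0 < b < 1 -> 0 < v ->
  is_derive b 1 (fun b => tail_density n b v)
    (tail_density_partial n b v).
Proof.
move=> b01 v0; have h := is_cderive_Im (is_cderive_tail n b01 v0).
exact: (is_deriveZ (expR (- (t * v)) * v^-1) h).
Qed.

Lemma density_shift (x v : R) : 0 < v ->
  expR (- (t * v)) * v^-1 * v `^ x = gamma_density t x v.
Proof.
move=> v0; rewrite /gamma_density powR_posD// powR_inv1 ?(ltW v0)//; ring.
Qed.

Lemma tail_density_le (n : nat) (b v : R) : 0 < b < 1 -> 0 < v ->
  `|tail_density n b v| <= (m b)^-1 * lam ^- n * gamma_density t (n%:R * b) v.
Proof.
move=> b01 v0; rewrite -density_shift// mulrCA normrM ger0_norm; last first.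
  by rewrite mulr_ge0 ?expR_ge0// invr_ge0 ltW.
rewrite ler_wpM2l//; first by rewrite mulr_ge0 ?expR_ge0// invr_ge0 ltW.
exact: le_trans (Im_le_normc _) (normc_tail_le n b01 v0).
Qed.

Lemma tail_density_partial_le (n : nat) (b v : R) : 0 < b < 1 -> 0 < v ->
  `|tail_density_partial n b v| <=
  (m b)^-1 * (n%:R + (m b)^-1) * lam ^- n *
    ((`|ln v| + pi) * gamma_density t (n%:R * b) v).
Proof.
move=> b01 v0; rewrite -density_shift//.
have e0 : 0 <= expR (- (t * v)) * v^-1 by rewrite mulr_ge0 ?expR_ge0// invr_ge0 ltW.
rewrite normrM ger0_norm//.
rewrite [leRHS](_ : _ = expR (- (t * v)) * v^-1 * ((`|ln v| + pi) *
  ((m b)^-1 * lam ^- n * v `^ (n%:R * b)) * (n%:R + (m b)^-1))); last by ring.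
rewrite ler_wpM2l//; apply: le_trans (Im_le_normc _) _.
rewrite normcM normcM; apply: ler_pM; rewrite ?mulr_ge0 ?normc_ge0//.
  apply: ler_pM; rewrite ?normc_ge0//; last exact: normc_tail_le.
  by apply: le_trans (normc_le_Im _) _; rewrite /= [`|pi|]ger0_norm.
apply: le_trans (normcD _ _) _; apply: lerD.
  by rewrite -(rmorph_nat (real_complex R)) normc_real ger0_norm.
by rewrite normcN; exact: normc_ratio_le.
Qed.

(** The sine comes from the phase e^(i pi n b) of q^n. *)
Lemma Im_spectral_ratio_pow (n : nat) (b v : R) : 0 < v ->
  Im (- (- q b v) ^+ n) = (-1) ^+ n.+1 * sin (pi * (n%:R * b)) * lam ^- n * v `^ (n%:R * b).
Proof.
move=> v0.
have e : (- q b v) ^+ n = ((-1) ^+ n * lam ^- n)%:C * cexp ((n%:R * b)%:C * log_polar v pi).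
  elim: n => [|n IH].
    by rewrite !expr0 !mul0r cexp0 invr1 !mulr1 rmorph1.
  rewrite exprS IH -natr1 mulrDl mul1r rmorphD mulrDl cexpD.
  rewrite !exprS invfM !rmorphM rmorphN1 !fmorphV /q /spectral_ratio.
  by ring.
rewrite e ImN Im_scale /cexp Re_scale Im_scale /= -powR_exp// exprS.
by rewrite [n%:R * b * pi]mulrC; ring.
Qed.

Lemma tail_densityB (n : nat) (b v : R) : 0 < b < 1 -> 0 < v ->
  tail_density n b v - tail_density n.+1 b v =
  (-1) ^+ n.+1 * sin (pi * (n%:R * b)) * lam ^- n * gamma_density t (n%:R * b) v.
Proof.
move=> b01 v0; rewrite /tail_density -mulrBr -ImN -ImD.
have D0 := spectral_den_neq0 b01 v0.
have -> : spectral_tail n b v - spectral_tail n.+1 b v = - (- q b v) ^+ n.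
  by rewrite /spectral_tail -/(q b v) exprS; move: (_ ^+ n) => X; field.
by rewrite Im_spectral_ratio_pow// -density_shift//; ring.
Qed.

(** The first tail is q / (1 + q) = s^b / (s^b + lam) on the upper side of the
    negative half-line. *)
Lemma tail_density1 (b v : R) : 0 < b < 1 -> 0 < v ->
  tail_density 1 b v = ray_density t b lam b v.
Proof.
move=> b01 v0; have D0 := spectral_den_neq0 b01 v0.
rewrite /tail_density /ray_density [_ * v^-1]mulrC -mulrA; congr (_ * _).
rewrite -Im_scale; congr Im.
rewrite /kernel mul1r cexpD.
have -> : cexp (t%:C * cexp (log_polar v pi)) = (expR (- (t * v)))%:C.
  rewrite cexp_log_polar// cospi sinpi /cexp Re_scale Im_scale /=.
  by rewrite mulrN1 mulrN !mulr0 cos0 sin0 mulr1 mulr0.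
rewrite /spectral_tail expr1 opprK -/(q b v) denE /q /spectral_ratio.
have D1 : cexp (b%:C * log_polar v pi) + lam%:C != 0.
  by move: D0; rewrite denE mulf_eq0 negb_or => /andP[].
by field; rewrite D1 lamC0.
Qed.
End tail.

(** * The remainder and its derivative in the exponent *)

Section remainder.
Context {R : realType}.
Notation mu := (@lebesgue_measure R).

(** ln x <= x at x = y^e and at x = y^(-e). *)
Lemma normr_ln_le (e y : R) : 0 < e -> 0 < y ->
  `|ln y| <= e^-1 * (y `^ e + y `^ (- e)).
Proof.
move=> e0 y0; rewrite [leRHS]mulrC ler_pdivlMr//.
have h1 := ln_sublinear (powR_gt0 e y0); rewrite ln_powR in h1.
have h2 := ln_sublinear (powR_gt0 (- e) y0); rewrite ln_powR in h2.
have p1 := powR_ge0 y e; have p2 := powR_ge0 y (- e).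
rewrite -[X in _ * X](gtr0_norm e0) -normrM ler_norml.
move: h1 h2; rewrite mulNr [e * _]mulrC => h1 h2.
by apply/andP; split; lra.
Qed.

(** Bounds Gamma on an interval without monotonicity or convexity: the powers in
    the integrand are dominated by those at the two ends. *)
Lemma Gamma_interp (p s y : R) : 0 < p -> p <= y <= s -> Gamma y <= Gamma p + Gamma s.
Proof.
move=> p0 /[dup] /andP[py ys] pys.
have y0 := lt_le_trans p0 py.
have s0 := lt_le_trans y0 ys.
have Ip := gamma_density_integrable ltr01 p0.
have Is := gamma_density_integrable ltr01 s0.
have Iy := gamma_density_integrable ltr01 y0.
rewrite !GammaE -RintegralD//; apply: le_Rintegral => //.
  exact: integrable_itvD.
move=> v; rewrite /= in_itv /= andbT => v0.
rewrite /gamma_density -mulrDr ler_wpM2l ?expR_ge0//.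
by apply: powR_interp => //; rewrite !lerD2r.
Qed.

Section log_density.
Variable t : R.
Hypothesis t0 : 0 < t.

(** Dominates the derivative of the tail density in the exponent: the factor
    |ln v| + pi bounds |ln v + i pi|. *)
Definition log_density (x v : R) : R := (`|ln v| + pi) * gamma_density t x v.

Let majorant (e x v : R) : R :=
  e^-1 * t `^ e * gamma_density t (x + e) v +
  (e^-1 * t `^ (- e) * gamma_density t (x - e) v +
   (`|ln t| + pi) * gamma_density t x v).

(** |ln v| <= |ln (t v)| + |ln t|, and |ln (t v)| is at most a multiple of
    (t v)^e + (t v)^(-e); these powers of v only shift the exponent of the Gamma density. *)
Let majorant_ge (e x v : R) : 0 < e -> 0 < v -> log_density x v <= majorant e x v.
Proof.
move=> e0 v0; have tv0 : 0 < t * v by rewrite mulr_gt0.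
have h : `|ln v| <= e^-1 * ((t * v) `^ e + (t * v) `^ (- e)) + `|ln t|.
  have -> : ln v = ln (t * v) - ln t by rewrite lnM ?posrE//; ring.
  by apply: le_trans (ler_normB _ _) _; rewrite lerD2r normr_ln_le.
rewrite !(powRM _ (ltW t0) (ltW v0)) in h.
have hp : gamma_density t (x + e) v = v `^ e * gamma_density t x v.
  rewrite /gamma_density (_ : x + e - 1 = e + (x - 1)); last by ring.
  by rewrite (powR_posD e (x - 1) v0); ring.
have hm : gamma_density t (x - e) v = v `^ (- e) * gamma_density t x v.
  rewrite /gamma_density (_ : x - e - 1 = - e + (x - 1)); last by ring.
  by rewrite (powR_posD (- e) (x - 1) v0); ring.
rewrite /majorant hp hm /log_density.
have -> : e^-1 * t `^ e * (v `^ e * gamma_density t x v) +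
   (e^-1 * t `^ (- e) * (v `^ (- e) * gamma_density t x v) +
   (`|ln t| + pi) * gamma_density t x v) =
   (e^-1 * (t `^ e * v `^ e + t `^ (- e) * v `^ (- e)) + `|ln t| + pi) *
   gamma_density t x v by ring.
by rewrite ler_wpM2r ?gamma_density_ge0// lerD2r.
Qed.

Let majorant_integrable (e x : R) : 0 < e -> e < x ->
  mu.-integrable `]0, +oo[ (EFin \o majorant e x).
Proof.
move=> e0 ex; have x0 := lt_trans e0 ex.
by apply: integrable_itvD; [|apply: integrable_itvD]; apply: integrable_itvZ;
  apply: gamma_density_integrable => //; lra.
Qed.

Lemma log_density_ge0 (x v : R) : 0 <= log_density x v.
Proof. by rewrite mulr_ge0 ?gamma_density_ge0// addr_ge0 ?pi_ge0. Qed.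

Lemma log_density_continuous (x v : R) : 0 < v -> {for v, continuous (log_density x)}.
Proof.
move=> v0; apply: continuousM; last exact: gamma_density_continuous.
apply: continuousD; last exact: cst_continuous.
by apply: cvg_norm; exact: continuous_ln.
Qed.

Lemma log_density_integrable (x : R) : 0 < x ->
  mu.-integrable `]0, +oo[ (EFin \o log_density x).
Proof.
move=> x0; have x20 : 0 < x / 2 by rewrite divr_gt0.
apply: (@integrable_pos_le _ _ (majorant (x / 2) x)).
- by move=> v; exact: log_density_continuous.
- by move=> v v0; rewrite ger0_norm ?log_density_ge0// majorant_ge.
- by apply: majorant_integrable => //; lra.
Qed.

(** Splitting ln v as ln (t v) - ln t leaves the scale t^(-x) in every term; the
    only further dependence on t is the explicit |ln t|. *)
Lemma Rintegral_log_density_le (e x : R) : 0 < e -> e < x ->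
  \int[mu]_(v in `]0, +oo[) log_density x v <=
  t `^ (- x) * (e^-1 * (Gamma (x + e) + Gamma (x - e)) + (`|ln t| + pi) * Gamma x).
Proof.
move=> e0 ex; have x0 := lt_trans e0 ex.
have xe : 0 < x + e by lra.
have xe' : 0 < x - e by lra.
have I1 := gamma_density_integrable t0 xe.
have I2 := gamma_density_integrable t0 xe'.
have I3 := gamma_density_integrable t0 x0.
apply: (@le_trans _ _ (\int[mu]_(v in `]0, +oo[) majorant e x v)).
  apply: le_Rintegral => //.
  - exact: log_density_integrable.
  - exact: majorant_integrable.
  - by move=> v; rewrite /= in_itv /= andbT; exact: majorant_ge.
rewrite /majorant RintegralD//; last 2 first.
- exact: integrable_itvZ.
- by apply: integrable_itvD; exact: integrable_itvZ.
rewrite RintegralD//; last 2 first.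
- exact: integrable_itvZ.
- exact: integrable_itvZ.
rewrite !RintegralZl//.
rewrite (Rintegral_gamma_density t0 xe) (Rintegral_gamma_density t0 xe') (Rintegral_gamma_density t0 x0).
(* The factors t^e and t^(-e) of the majorant cancel against those of the
   shifted Gamma integrals. *)
have e1 : t `^ (- (x + e)) = t `^ (- e) * t `^ (- x).
  by rewrite -powR_posD//; congr powR; ring.
have e2 : t `^ (- (x - e)) = t `^ e * t `^ (- x).
  by rewrite -powR_posD//; congr powR; ring.
have e3 : t `^ e * t `^ (- e) = 1 by rewrite -powR_posD// subrr powRr0.
rewrite e1 e2 le_eqVlt; apply/orP; left; apply/eqP.
rewrite -[e^-1 in RHS]mulr1 -e3.
by move: (Gamma _) (Gamma _) (Gamma _) => G1 G2 G3; ring.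
Qed.
End log_density.

Section remainder.
Variables t lam : R.
Hypotheses (t0 : 0 < t) (lam0 : 0 < lam).
Let m (b : R) := cos (b * pi / 2).

Definition spectral_remainder (n : nat) (b : R) : R :=
  pi^-1 * \int[mu]_(v in `]0, +oo[) tail_density t lam n b v.

Let mono (a b : R) : 0 < a -> a <= b -> b < 1 -> 0 < m b /\ m b <= m a.
Proof.
move=> a0 ab b1.
have p0 := pi_gt0 R.
have b0 := lt_le_trans a0 ab.
have bp : b * pi < pi by rewrite -[ltRHS]mul1r ltr_pM2r.
have ap : a * pi <= b * pi by rewrite ler_pM2r.
have ap0 : 0 <= a * pi by rewrite mulr_ge0 ?ltW.
split; first by apply: cos_half_gt0; apply/andP; split; lra.
rewrite /m leNgt ltr_cos ?in_itv /=; [|by apply/andP; split; lra..].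
by rewrite -leNgt ler_pM2r.
Qed.

Lemma tail_density_integrable (n : nat) (b : R) : (0 < n)%N -> 0 < b < 1 ->
  mu.-integrable `]0, +oo[ (EFin \o tail_density t lam n b).
Proof.
move=> n0 b01; have b0 : 0 < b by case/andP: b01.
apply: (integrable_pos_le _ (fun v => tail_density_le t lam0 n b01)).
  by move=> v; exact: tail_density_continuous.
by apply: integrable_itvZ; apply: gamma_density_integrable => //; rewrite mulr_gt0 ?ltr0n.
Qed.

Lemma spectral_remainder_le (n : nat) (b b1 : R) : (0 < n)%N -> 0 < b -> b <= b1 -> b1 < 1 ->
  `|spectral_remainder n b| <=
  (pi * m b1)^-1 * Gamma (n%:R * b) * (lam ^- n * t `^ (- (n%:R * b))).
Proof.
move=> n0 b0 bb1 b11.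
have b01 : 0 < b < 1 by rewrite b0 (le_lt_trans bb1).
have [m1 mm] := mono b0 bb1 b11.
have nb0 : 0 < n%:R * b by rewrite mulr_gt0 ?ltr0n.
have I := tail_density_integrable n0 b01.
have Ig := gamma_density_integrable t0 nb0.
rewrite /spectral_remainder normrM gtr0_norm ?invr_gt0 ?pi_gt0// invfM -!mulrA.
rewrite ler_wpM2l ?invr_ge0 ?pi_ge0//.
apply: le_trans (le_normr_Rintegral _ I) _ => //.
rewrite [leRHS](_ : _ = (m b1)^-1 * lam ^- n * (Gamma (n%:R * b) * t `^ (- (n%:R * b)))); last by ring.
rewrite -(Rintegral_gamma_density t0 nb0) -RintegralZl//.
apply: le_Rintegral => //.
- exact: integrable_norm.
- exact: integrable_itvZ.
- move=> v; rewrite /= in_itv /= andbT => v0.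
  apply: le_trans (tail_density_le t lam0 n b01 v0) _.
  rewrite ler_wpM2r ?gamma_density_ge0// ler_wpM2r ?invr_ge0 ?exprn_ge0 ?(ltW lam0)//.
  by rewrite lef_pV2 ?posrE// (lt_le_trans m1).
Qed.

(** One more term of the geometric expansion: a Gamma integral with the factor
    sin (pi n b) / pi, which the reflection formula absorbs. *)
Lemma spectral_remainderB (n : nat) (b : R) : (0 < n)%N -> 0 < b < 1 ->
  spectral_remainder n b - spectral_remainder n.+1 b =
  ml_coef n b * lam ^- n * t `^ (- (n%:R * b)).
Proof.
move=> n0 b01; have b0 : 0 < b by case/andP: b01.
have nb0 : 0 < n%:R * b by rewrite mulr_gt0 ?ltr0n.
have Ig := gamma_density_integrable t0 nb0.
rewrite /spectral_remainder -mulrBr -RintegralB//; try exact: tail_density_integrable.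
transitivity (pi^-1 * \int[mu]_(v in `]0, +oo[) ((-1) ^+ n.+1 * sin (pi * (n%:R * b)) * lam ^- n *
    gamma_density t (n%:R * b) v)).
  congr (_ * _); apply: eq_Rintegral => v; rewrite inE /= in_itv /= andbT => v0.
  exact: tail_densityB.
rewrite RintegralZl// (Rintegral_gamma_density t0 nb0) /ml_coef (recip_Gamma_reflection nb0).
by move: (Gamma _) (_ ^- n) (pi^-1) => G L p; ring.
Qed.

Lemma spectral_remainder1 (b : R) : 0 < b < 1 ->
  spectral_remainder 1 b = mittag_leffler b (- (lam * t `^ b)).
Proof.
move=> b01; rewrite (mittag_leffler_ray t0 b01 lam0); congr (_ * _).
apply: eq_Rintegral => v; rewrite inE /= in_itv /= andbT => v0.
exact: tail_density1.
Qed.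

(** Telescoping over the terms of the geometric expansion. *)
Lemma ml_remainderE (N : nat) (b : R) : 0 < b < 1 ->
  ml_remainder N b lam t = spectral_remainder N.+1 b.
Proof.
move=> b01; rewrite /ml_remainder -(spectral_remainder1 b01).
elim: N => [|N IH]; first by rewrite big_geq// subr0.
rewrite big_nat_recr// opprD addrA IH -spectral_remainderB//.
by rewrite opprB addrCA subrr addr0.
Qed.

Section derivative.
Variables (n : nat) (b : R).
Hypotheses (n0 : (0 < n)%N) (b01 : 0 < b < 1).

Let b0 : 0 < b. Proof. by case/andP: b01. Qed.
Let b1 : b < 1. Proof. by case/andP: b01. Qed.
(* Exponents in a neighbourhood of b that stays away from 0 and 1; on it the
   partial derivatives are dominated by the sum of the log densities at the ends. *)
Let lo := b / 2.
Let hi := (b + 1) / 2.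
Let I : set R := `]lo, hi[%classic.
Let Ib : I b.
Proof. by rewrite /I /= in_itv /= /lo /hi; apply/andP; split; have := b0; have := b1; lra. Qed.
Let lo0 : 0 < lo. Proof. by rewrite divr_gt0. Qed.
Let hi1 : hi < 1. Proof. by rewrite /hi; have := b1; lra. Qed.
Let I01 (x : R) : I x -> 0 < x < 1.
Proof.
by rewrite /I /= in_itv /= => /andP[h1 h2]; rewrite (lt_trans lo0 h1) (lt_trans h2 hi1).
Qed.
Let mB : measurable (`]0, +oo[%classic : set (measurableTypeR R)).
Proof. exact: measurable_itv. Qed.
Let bound (x : R) := (m x)^-1 * (n%:R + (m x)^-1) * lam ^- n.
Let G (v : R) : R := bound hi * (log_density t (n%:R * lo) v + log_density t (n%:R * hi) v).
Let nlo : 0 < n%:R * lo. Proof. by rewrite mulr_gt0 ?ltr0n. Qed.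
Let nhi : 0 < n%:R * hi.
Proof. by rewrite mulr_gt0 ?ltr0n// /hi; have := b0; lra. Qed.

Let bound_le (x y : R) : 0 < x -> x <= y -> y < 1 -> 0 <= bound x <= bound y.
Proof.
move=> x0 xy y1; have [m1 mm] := mono x0 xy y1.
have m2 := lt_le_trans m1 mm.
have i : (m x)^-1 <= (m y)^-1 by rewrite lef_pV2 ?posrE.
have ix : 0 <= (m x)^-1 by rewrite invr_ge0 ltW.
have L : 0 <= lam ^- n by rewrite invr_ge0 exprn_ge0// ltW.
rewrite /bound !mulr_ge0 ?addr_ge0//= ler_wpM2r//.
by apply: ler_pM => //; rewrite ?addr_ge0// lerD2l.
Qed.

Let int_tail (x : R) : I x -> mu.-integrable `]0, +oo[ (EFin \o tail_density t lam n x).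
Proof. by move=> /I01; exact: tail_density_integrable. Qed.

Let der_tail (x v : R) : I x -> `]0, +oo[%classic v -> derivable (fun b => tail_density t lam n b v) x 1.
Proof.
move=> /I01 x01; rewrite /= in_itv /= andbT => v0.
by have [] := is_derive_tail_density t lam0 n x01 v0.
Qed.

Let d1_tail (x v : R) : I x -> `]0, +oo[%classic v ->
  partial1of2 (tail_density t lam n) x v = tail_density_partial t lam n x v.
Proof.
move=> /I01 x01; rewrite /= in_itv /= andbT => v0.
by rewrite partial1of2E; have [_ ->] := is_derive_tail_density t lam0 n x01 v0.
Qed.

Let G0 (v : R) : 0 <= G v.
Proof.
have hb : 0 <= bound hi <= bound hi by apply: bound_le => //; rewrite /hi; have := b0; lra.
by rewrite /G mulr_ge0 ?addr_ge0 ?log_density_ge0//; case/andP: hb.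
Qed.

Let intG : mu.-integrable `]0, +oo[ (EFin \o G).
Proof.
by apply: integrable_itvZ; apply: integrable_itvD; exact: log_density_integrable.
Qed.

Let G_ub (x v : R) : I x -> `]0, +oo[%classic v ->
  `|partial1of2 (tail_density t lam n) x v| <= G v.
Proof.
move=> Ix Pv; rewrite d1_tail//; have x01 := I01 Ix.
move: Ix Pv; rewrite /I /= !in_itv /= andbT => /andP[lx xh] v0.
apply: le_trans (tail_density_partial_le t lam0 n x01 v0) _.
have x0 : 0 < x by case/andP: x01.
have /andP[h1 h2] := bound_le x0 (ltW xh) hi1.
rewrite /G; apply: ler_pM => //; first exact: log_density_ge0.
rewrite /log_density -mulrDr ler_wpM2l ?(addr_ge0 (normr_ge0 (ln v)) (pi_ge0 R))//.
rewrite /gamma_density -mulrDr.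
rewrite ler_wpM2l ?expR_ge0//; apply: powR_interp => //.
by rewrite !lerD2r !ler_wpM2l// ?ltW.
Qed.

(** Differentiation under the integral sign, with G as the dominating
    function. *)
Lemma is_derive_spectral_remainder :
  is_derive b 1 (spectral_remainder n)
    (pi^-1 * \int[mu]_(v in `]0, +oo[) tail_density_partial t lam n b v).
Proof.
have hd := derivable_under_integral mB Ib int_tail der_tail G0 intG G_ub.
have hD := differentiation_under_integral mB Ib int_tail der_tail G0 intG G_ub.
have h : is_derive b 1 (fun x => \int[mu]_(v in `]0, +oo[) tail_density t lam n x v)
    (\int[mu]_(v in `]0, +oo[) tail_density_partial t lam n b v).
  split; first exact: hd.
  rewrite -derive1E hD; apply: eq_Rintegral => v; rewrite inE => vP.
  exact: d1_tail.
exact: (is_deriveZ pi^-1 h).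
Qed.

Lemma spectral_remainder_derive_le (c e : R) : b <= c -> c < 1 -> 0 < e -> e < n%:R * b ->
  `|pi^-1 * \int[mu]_(v in `]0, +oo[) tail_density_partial t lam n b v| <=
  pi^-1 * ((m c)^-1 * (n%:R + (m c)^-1)) *
  (e^-1 * (Gamma (n%:R * b + e) + Gamma (n%:R * b - e)) + (`|ln t| + pi) * Gamma (n%:R * b)) *
  (lam ^- n * t `^ (- (n%:R * b))).
Proof.
move=> bc c1 e0 eb.
have nb0 : 0 < n%:R * b by rewrite mulr_gt0 ?ltr0n.
have /andP[B0 B1] := bound_le b0 bc c1.
have dI : mu.-integrable `]0, +oo[ (EFin \o tail_density_partial t lam n b).
  apply: (@integrable_pos_le _ _ (fun v => bound b * log_density t (n%:R * b) v)).
  - by move=> v; exact: tail_density_partial_continuous.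
  - by move=> v v0; apply: tail_density_partial_le.
  - by apply: integrable_itvZ; exact: log_density_integrable.
have LI := log_density_integrable t0 nb0.
rewrite normrM gtr0_norm ?invr_gt0 ?pi_gt0// -!mulrA.
rewrite ler_wpM2l ?invr_ge0 ?pi_ge0//.
apply: le_trans (le_normr_Rintegral _ dI) _ => //.
apply: (@le_trans _ _ (bound c * \int[mu]_(v in `]0, +oo[) log_density t (n%:R * b) v)).
  rewrite -RintegralZl//; apply: le_Rintegral => //.
  - exact: integrable_norm.
  - exact: integrable_itvZ.
  - move=> v; rewrite /= in_itv /= andbT => v0.
    apply: le_trans (tail_density_partial_le t lam0 n b01 v0) _.
    by rewrite ler_wpM2r ?log_density_ge0.
have h := Rintegral_log_density_le t0 e0 eb.
apply: le_trans (ler_wpM2l (le_trans B0 B1) h) _.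
rewrite /bound le_eqVlt; apply/orP; left; apply/eqP.
by move: (Gamma _) (Gamma _) (Gamma _) => G1 G2 G3; ring.
Qed.

End derivative.
End remainder.
End remainder.

(** * The terms of the expansion, and the theorem *)

Section terms.
Context {R : realType}.

Lemma is_derive_near_eq (f g : R -> R) (x d : R) :
  (\forall y \near x, f y = g y) -> is_derive x 1 f d -> is_derive x 1 g d.
Proof.
move=> fg [df <-]; split; first exact: near_eq_derivable fg df.
by apply/esym; apply: near_eq_derive fg.
Qed.

Lemma near_itvoo01 (a : R) : 0 < a < 1 -> \forall b \near a, 0 < b < 1.
Proof.
move=> a01; have h : a \in `]0, 1[ by rewrite in_itv.
by have := near_in_itvoo h; apply: filterS => b; rewrite in_itv.
Qed.

Lemma is_derive_sum_nat (f : nat -> R -> R) (d : nat -> R) (x : R) (N : nat) :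
  (forall k, (1 <= k <= N)%N -> is_derive x 1 (f k) (d k)) ->
  is_derive x 1 (fun y => \sum_(1 <= k < N.+1) f k y) (\sum_(1 <= k < N.+1) d k).
Proof.
elim: N => [|N IH] h.
  rewrite big_geq// (_ : (fun y => _) = cst 0).
    exact: is_derive_cst.
  by apply/funext => y; rewrite big_geq.
rewrite big_nat_recr// (_ : (fun y => _) = (fun y => \sum_(1 <= k < N.+1) f k y) + f N.+1).
  apply: is_deriveD; last by apply: h; rewrite /= leqnn.
  by apply: IH => k /andP[k1 kN]; apply: h; rewrite k1 leqW.
by apply/funext => y; rewrite big_nat_recr.
Qed.

(** The coefficient is the difference of two consecutive remainders at
    lam = t = 1, which are differentiable integrals. *)
Lemma ml_coef_derivable (k : nat) (a : R) : (0 < k)%N -> 0 < a < 1 ->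
  derivable (fun b : R => ml_coef k b) a 1.
Proof.
move=> k0 a01.
have h1 := is_derive_spectral_remainder (@ltr01 R) (@ltr01 R) k0 a01.
have h2 := is_derive_spectral_remainder (@ltr01 R) (@ltr01 R) (ltn0Sn k) a01.
have h := is_deriveB h1 h2.
suff E : \forall b \near a, (spectral_remainder 1 1 k - spectral_remainder 1 1 k.+1) b = ml_coef k b.
  by have [] := is_derive_near_eq E h.
near=> b.
have b01 : 0 < b < 1 by near: b; exact: near_itvoo01.
have := spectral_remainderB ltr01 ltr01 k0 b01.
by rewrite expr1n invr1 powR1 !mulr1.
Unshelve. all: by end_near. Qed.

Lemma is_derive_asymptotic_term (k : nat) (a lam t : R) : (0 < k)%N -> 0 < a < 1 -> 0 < t ->
  is_derive a 1 (fun b => ml_coef k b * lam ^- k * t `^ (- (k%:R * b)))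
    (lam ^- k * t `^ (- (k%:R * a)) *
      (derive1 (fun b : R => ml_coef k b) a - k%:R * ml_coef k a * ln t)).
Proof.
move=> k0 a01 t0.
have hc : is_derive a 1 (fun b => ml_coef k b) (derive1 (fun b : R => ml_coef k b) a).
  by rewrite derive1E; apply: DeriveDef => //; exact: ml_coef_derivable.
have hl : is_derive a 1 (fun b : R => - (k%:R * ln t) * b) (- (k%:R * ln t)).
  have := is_deriveZ (- (k%:R * ln t)) (is_derive_id a 1).
  by rewrite /GRing.scale /= mulr1; apply.
have ht : is_derive a 1 (fun b : R => t `^ (- (k%:R * b)))
    (t `^ (- (k%:R * a)) * - (k%:R * ln t)).
  have h := @is_derive1_comp _ expR (fun b : R => - (k%:R * ln t) * b) _ _ _ (is_derive_expR _) hl.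
  have E b : t `^ (- (k%:R * b)) = expR (- (k%:R * ln t) * b).
    by rewrite powR_exp//; congr expR; ring.
  rewrite (_ : (fun b : R => t `^ (- (k%:R * b))) = (expR \o (fun b : R => - (k%:R * ln t) * b))).
    by rewrite E; exact: h.
  by apply/funext => b; exact: E.
have h := is_deriveM (is_deriveM hc (is_derive_cst (lam ^- k) a 1)) ht.
apply: (@is_derive_eq _ _ _ _ _ _ _ _ h).
rewrite !fctE /GRing.scale /=.
by move: (derive1 _ _) (ml_coef _ _) (lam ^- k) => D c L; ring.
Qed.

End terms.

Unset Implicit Arguments.

Theorem theorem3p1 (R : realType) (a0 a1 lam0 : R) (N : nat)
  (ha0 : 0 < a0) (ha01 : a0 <= a1) (ha1 : a1 < 1)
  (hlam0 : 0 < lam0) (hN : (1 <= N)%N) :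
  exists C T : R, [/\ 0 < C, 1 < T &
    forall a lam t : R, a0 <= a <= a1 -> lam0 <= lam -> T <= t ->
      (mittag_leffler a (- (lam * t `^ a)) =
         \sum_(1 <= k < N.+1) ml_coef k a * lam ^- k * t `^ (- (k%:R * a))
         + ml_remainder N a lam t
       /\ `|ml_remainder N a lam t|
            <= C * lam ^- N.+1 * t `^ (- (N.+1%:R * a)))
      /\
      [/\ derivable (fun b : R => mittag_leffler b (- (lam * t `^ b))) a 1,
          forall k : nat, (1 <= k <= N)%N ->
            derivable (fun b : R => ml_coef k b) a 1,
          derivable (fun b : R => ml_remainder N b lam t) a 1,
          derive1 (fun b : R => mittag_leffler b (- (lam * t `^ b))) a =
            \sum_(1 <= k < N.+1) lam ^- k * t `^ (- (k%:R * a)) *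
               (derive1 (fun b : R => ml_coef k b) a
                - k%:R * ml_coef k a * ln t)
            + derive1 (fun b : R => ml_remainder N b lam t) a &
          `|derive1 (fun b : R => ml_remainder N b lam t) a|
            <= C * (1 + ln t) * lam ^- N.+1 * t `^ (- (N.+1%:R * a))]].
Proof.
pose n : R := N.+1%:R.
have n0 : 0 < n by rewrite ltr0n.
have a10 : 0 < a1 := lt_le_trans ha0 ha01.
(* The width of the shift in Rintegral_log_density_le.  With this choice the
   arguments n a, n a + e and n a - e stay in [e, n a1 + e] for all a in
   [a0, a1], so that M bounds Gamma at each of them. *)
pose e := n * a0 / 2.
have na0 : 0 < n * a0 by rewrite mulr_gt0.
have e0 : 0 < e by rewrite divr_gt0.
pose m : R := cos (a1 * pi / 2).
have m0 : 0 < m.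
  apply: cos_half_gt0; rewrite mulr_ge0 ?pi_ge0 ?(ltW a10)//=.
  by rewrite -[ltRHS]mul1r ltr_pM2r ?pi_gt0.
pose M := Gamma e + Gamma (n * a1 + e).
have M0 : 0 < M by rewrite addr_gt0 ?Gamma_gt0// addr_gt0// mulr_gt0.
have HM a y : a0 <= a <= a1 -> n * a - e <= y <= n * a + e -> Gamma y <= M.
  move=> /andP[h1 h2] /andP[h3 h4]; apply: Gamma_interp => //.
  have : n * a0 <= n * a by rewrite ler_pM2l.
  have : n * a <= n * a1 by rewrite ler_pM2l.
  by move: h3 h4; rewrite /e => *; apply/andP; split; lra.
have p0 : 0 < pi := pi_gt0 R.
pose CR := (pi * m)^-1 * M.
pose CK := pi^-1 * (m^-1 * (n + m^-1)).
pose CD := CK * ((e^-1 * 2 + pi) * M).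
have CR0 : 0 < CR by rewrite mulr_gt0// invr_gt0 mulr_gt0.
have mi : 0 < m^-1 by rewrite invr_gt0.
have pi' : 0 < pi^-1 :> R by rewrite invr_gt0.
have ei : 0 < e^-1 by rewrite invr_gt0.
have CK0 : 0 < CK by rewrite !mulr_gt0// addr_gt0.
have CD0 : 0 < CD by rewrite !mulr_gt0// addr_gt0// mulr_gt0.
(* For t >= 1 the logarithm is nonnegative, so that |ln t| = ln t. *)
exists (CR + CD), 2; split; [exact: addr_gt0|by rewrite ltr1n|].
move=> a lam t a01 hlam ht.
have lam0' := lt_le_trans hlam0 hlam.
have t0 : 0 < t by rewrite (lt_le_trans _ ht).
have t1 : 1 <= t by rewrite (le_trans _ ht)// ler1n.
have l0 : 0 <= ln t by rewrite ln_ge0.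
have /andP[aa0 aa1] := a01.
have ap : 0 < a := lt_le_trans ha0 aa0.
have a1' : a < 1 := le_lt_trans aa1 ha1.
have ab : 0 < a < 1 by rewrite ap.
pose B := lam ^- N.+1 * t `^ (- (n * a)).
have B0 : 0 <= B by rewrite mulr_ge0 ?powR_ge0// invr_ge0 exprn_ge0// ltW.
have nae : e < n * a.
  have : n * a0 <= n * a by rewrite ler_pM2l.
  by rewrite /e; lra.
have hr := is_derive_spectral_remainder t0 lam0' (ltn0Sn N) ab.
set D := (X in is_derive _ _ _ X) in hr.
have dr : is_derive a 1 (fun b : R => ml_remainder N b lam t) D.
  apply: is_derive_near_eq hr; near=> b.
  have b01 : 0 < b < 1 by near: b; exact: near_itvoo01.
  by rewrite ml_remainderE.
have ds : is_derive a 1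
    (fun b => \sum_(1 <= k < N.+1) ml_coef k b * lam ^- k * t `^ (- (k%:R * b)))
    (\sum_(1 <= k < N.+1) lam ^- k * t `^ (- (k%:R * a)) *
      (derive1 (fun b : R => ml_coef k b) a - k%:R * ml_coef k a * ln t)).
  apply: is_derive_sum_nat => k /andP[k1 _].
  exact: is_derive_asymptotic_term.
have dm : is_derive a 1 (fun b : R => mittag_leffler b (- (lam * t `^ b)))
    (\sum_(1 <= k < N.+1) lam ^- k * t `^ (- (k%:R * a)) *
      (derive1 (fun b : R => ml_coef k b) a - k%:R * ml_coef k a * ln t) + D).
  apply: is_derive_near_eq (is_deriveD ds dr); near=> b.
  by rewrite /ml_remainder /= addrC subrK.
have e0' : - e <= 0 by rewrite oppr_le0 ltW.
have ee : - e <= e := le_trans e0' (ltW e0).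
have Gna : Gamma (n * a) <= M by apply: (HM a) => //; rewrite gerDl lerDl e0' ltW.
split; [split|split].
- by rewrite /ml_remainder addrC subrK.
- rewrite ml_remainderE// -mulrA -/B.
  apply: le_trans (spectral_remainder_le t0 lam0' (ltn0Sn N) ap aa1 ha1) _.
  rewrite ler_wpM2r//; apply: (@le_trans _ _ CR); last by rewrite lerDl ltW.
  by rewrite /CR ler_wpM2l// invr_ge0 mulr_ge0 ?ltW.
- by case: dm.
- by move=> k /andP[k1 _]; exact: ml_coef_derivable.
- by case: dr.
- rewrite !derive1E; have [_ ->] := dm; have [_ ->] := dr.
  by congr (_ + _); apply: eq_bigr => k _; rewrite derive1E.
- rewrite derive1E; have [_ ->] := dr; rewrite -mulrA -/B.
  apply: le_trans (spectral_remainder_derive_le t0 lam0' (ltn0Sn N) ab aa1 ha1 e0 nae) _.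
  rewrite ler_wpM2r// -/n -/m -/CK.
  apply: (@le_trans _ _ (CD * (1 + ln t))); last first.
    by rewrite ler_wpM2r ?addr_ge0// lerDr ltW.
  rewrite /CD -mulrA ler_wpM2l ?(ltW CK0)// ger0_norm//.
  have G1 : Gamma (n * a + e) <= M by apply: (HM a) => //; rewrite !lerD2l ?ee ?lexx.
  have G2 : Gamma (n * a - e) <= M by apply: (HM a) => //; rewrite !lerD2l ?ee ?lexx.
  have p1 : 1 <= pi :> R by apply: le_trans (pi_ge2 R); rewrite ler1n.
  have h1 : e^-1 * (Gamma (n * a + e) + Gamma (n * a - e)) <= e^-1 * (2 * M).
    by apply: ler_wpM2l; [exact: ltW|rewrite mulr_natl mulr2n lerD].
  have h2 : (ln t + pi) * Gamma (n * a) <= (ln t + pi) * M.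
    by apply: ler_wpM2l; [exact: (addr_ge0 l0 (ltW p0))|exact: Gna].
  have h3 : 0 <= ln t * (e^-1 * 2 + pi - 1) * M.
    apply: mulr_ge0 (ltW M0); apply: mulr_ge0 => //.
    by rewrite -addrA; apply: addr_ge0; [rewrite mulr_ge0 ?(ltW ei)|rewrite subr_ge0].
  apply: le_trans (lerD h1 h2) _.
  rewrite -subr_ge0 (_ : _ - _ = ln t * (e^-1 * 2 + pi - 1) * M)//.
  by move: (pi : R) => p; ring.
Unshelve. all: by end_near. Qed.
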